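(* Consider the problem $-\varepsilon\Delta u-bu_x+cu=f$ in $\Omega=(0,1)^2$, $u=0$ on $\partial\Omega$, with data as in the context. Assume that its solution $u$ satisfies, for some $\delta>0$, with $E(y)=e^{-y\delta/\sqrt\varepsilon}+e^{-(1-y)\delta/\sqrt\varepsilon}$ and a constant $C'$ independent of $\varepsilon$, $$|\partial_x^i\partial_y^ju(x,y)|\le C'\Big(1+\varepsilon^{-i}e^{-\beta x/\varepsilon}+\varepsilon^{-j/2}E(y)+\varepsilon^{-(i+j/2)}e^{-\beta x/\varepsilon}E(y)\Big)$$ for all $(x,y)\in\Omega$ and $0\le i+j\le2$. Let $u^I$ be the piecewise bilinear nodal interpolant of $u$ on the DL mesh, and let $M$ be the total number of mesh points. Let the streamline diffusion parameters be $\varrho_\tau=\varrho_i\ge0$ for $\tau\subset\Omega_i$, $i=1,2,3$, with $$\varrho_1\le C_\varrho\,\varepsilon M^{-1},\qquad \varrho_2\le C_\varrho\,\varepsilon^{-1/4}M^{-1},\qquad \varrho_3\le C_\varrho\begin{cases}\varepsilon^{-1}M^{-1}, & M^{-1/2}\le\varepsilon,\\ M^{-1/2}, & M^{-1/2}\ge\varepsilon,\end{cases}$$ where $C_\varrho$ is independent of $\varepsilon$ and $h$. Then there is a constant $C$ independent of $\varepsilon$ and $h$ such that $$\|u-u^I\|_{SD}\le C\,h\qquad\text{and}\qquad h\le C\,\frac{1}{\sqrt M}|\ln\varepsilon|.$$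
   Context: **Problem.** $\Omega=(0,1)^2$; $b\in W^{1,\infty}(\Omega)$, $c\in L^\infty(\Omega)$, $b\ge\beta>0$ and $c\ge0$ on $\bar\Omega$, $c+\frac12 b_x\ge\gamma>0$ on $\Omega$, with $\beta,\gamma$ constants; $f\in L^2(\Omega)$. The parameter satisfies $0<\varepsilon\ll1$, i.e. $0<\varepsilon\le\varepsilon_0$ for a sufficiently small fixed $\varepsilon_0\in(0,1)$ independent of $h$. The functions $b,c$ do not depend on $\varepsilon$. **DL (Duran–Lombardi) mesh.** Let $0<h<1$. In $x$: $x_0=0$; $x_i=ih\varepsilon$ for $1\le i\le\lceil1/h\rceil$; $x_{i+1}=x_i+hx_i$ for $\lceil1/h\rceil\le i\le M_x-2$; $x_{M_x}=1$, where $M_x$ is such that $x_{M_x-1}<1\le(1+h)x_{M_x-1}$. In $y$: $y_0=0$; $y_j=jh\sqrt\varepsilon$ for $1\le j\le\lceil1/h\rceil$; $y_{j+1}=y_j+hy_j$ for $\lceil1/h\rceil\le j\le M_y-2$; $y_{M_y}=1/2$, where $y_{M_y-1}<\frac12\le(1+h)y_{M_y-1}$; and $y_{M_y+j}=1-y_{M_y-j}$, $1\le j\le M_y$. The last interval $(x_{M_x-1},1)$ is assumed not too small compared with the previous one (its length is at least a fixed positive constant times that of the previous one); otherwise the node $x_{M_x-1}$ is removed. The same convention is used in $y$ at $1/2$, symmetrically. The mesh is the tensor product; its rectangles are $\tau=R_{ij}=[x_{i-1},x_i]\times[y_{j-1},y_j]$. **Subdomains.** Fix constants $c_1>3/\beta$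 and $c_2>3/(2\delta)$. $\Omega_1$ is the union of the $R_{ij}$ with $x_{i-1}<c_1\varepsilon|\ln\varepsilon|$. $\Omega_2$ is the union of those with $x_{i-1}\ge c_1\varepsilon|\ln\varepsilon|$ and ($y_{j-1}<c_2\sqrt\varepsilon|\ln\varepsilon|$ or $y_{j-1}>1-c_2\sqrt\varepsilon|\ln\varepsilon|$). $\Omega_3$ is the union of those with $x_{i-1}\ge c_1\varepsilon|\ln\varepsilon|$ and $c_2\sqrt\varepsilon|\ln\varepsilon|\le y_{j-1}\le1-c_2\sqrt\varepsilon|\ln\varepsilon|$. **Norms.** $\|v\|_\varepsilon^2=\varepsilon\|\nabla v\|_{0,\Omega}^2+\|v\|_{0,\Omega}^2$ and $\|v\|_{SD}^2=\|v\|_\varepsilon^2+\sum_\tau\varrho_\tau\|bv_x\|_{0,\tau}^2$, with $\|\cdot\|_{0,D}$ the $L^2(D)$ norm. *)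

(* Defs.v *)
From mathcomp Require Import all_boot all_order all_algebra.
From mathcomp Require Import all_classical all_reals all_analysis.

Set Implicit Arguments.
Unset Strict Implicit.
Unset Printing Implicit Defensive.

Import Order.TTheory GRing.Theory Num.Theory.
Import numFieldNormedType.Exports.
Local Open Scope classical_set_scope.
Local Open Scope ring_scope.

Definition Omega {R : realType} : set (R * R) :=
  [set z | 0 < z.1 < 1 /\ 0 < z.2 < 1].

Definition Omegabar {R : realType} : set (R * R) :=
  [set z | 0 <= z.1 <= 1 /\ 0 <= z.2 <= 1].

Definition mu2 (R : realType) := (@lebesgue_measure R \x @lebesgue_measure R)%E.
Arguments mu2 : clear implicits.

(* Classical partial derivatives; the value is a library default at the points
   where the derivative does not exist. *)
Definition Dx {R : realType} (v : R * R -> R) : R * R -> R :=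
  fun z => derive1 (fun t => v (t, z.2)) z.1.

Definition Dy {R : realType} (v : R * R -> R) : R * R -> R :=
  fun z => derive1 (fun t => v (z.1, t)) z.2.

Definition Dxy {R : realType} (i j : nat) (v : R * R -> R) : R * R -> R :=
  iter i Dx (iter j Dy v).

(* v is of class C^k on the open set U. *)
Fixpoint Ck {R : realType} (k : nat) (U : set (R * R)) (v : R * R -> R) : Prop :=
  (forall z, U z -> {for z, continuous v}) /\
  (if k is k'.+1 then
     [/\ forall z, U z -> derivable (fun t => v (t, z.2)) z.1 1,
         forall z, U z -> derivable (fun t => v (z.1, t)) z.2 1,
         Ck k' U (Dx v) & Ck k' U (Dy v)]
   else True).

(* C_c^oo(Omega), extended by zero to the plane. *)
Definition test_function {R : realType} (phi : R * R -> R) : Prop :=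
  (forall k, Ck k setT phi) /\
  (exists K : set (R * R),
     [/\ compact K, K `<=` Omega & forall z, ~ K z -> phi z = 0]).

Definition L2sq {R : realType} (D : set (R * R)) (v : R * R -> R) : \bar R :=
  (\int[mu2 R]_(z in D) ((v z) ^+ 2)%:E)%E.

Definition L2 {R : realType} (f : R * R -> R) : Prop :=
  measurable_fun Omega f /\ (L2sq Omega f < +oo)%E.

Definition Loo {R : realType} (g : R * R -> R) : Prop :=
  measurable_fun Omega g /\
  exists K : R, {ae mu2 R, forall z, Omega z -> `|g z| <= K}.

(* dg is the weak derivative of g on Omega in the direction of D = Dx, Dy. *)
Definition weak_partial {R : realType}
    (D : (R * R -> R) -> R * R -> R) (g dg : R * R -> R) : Prop :=
  forall phi, test_function phi ->
    (\int[mu2 R]_(z in Omega) (g z * D phi z)%:E =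
     - \int[mu2 R]_(z in Omega) (dg z * phi z)%:E)%E.

(* g belongs to W^{1,oo}(Omega), with weak gradient (gx, gy). *)
Definition W1oo {R : realType} (g gx gy : R * R -> R) : Prop :=
  [/\ Loo g, Loo gx, Loo gy, weak_partial Dx g gx & weak_partial Dy g gy].

(* c and f are only defined up to null sets, so the equation is required
   almost everywhere. *)
Definition solves {R : realType} (eps : R) (b c f u : R * R -> R) : Prop :=
  [/\ {within Omegabar, continuous u},
      forall z, (Omegabar `\` Omega) z -> u z = 0,
      Ck 2 Omega u
    & {ae mu2 R, forall z, Omega z ->
        - eps * (Dxy 2 0 u z + Dxy 0 2 u z) - b z * Dx u z + c z * u z = f z}].

Definition Elayer {R : realType} (eps delta y : R) : R :=
  expR (- (y * delta / Num.sqrt eps)) +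
  expR (- ((1 - y) * delta / Num.sqrt eps)).

Definition derivative_bounds {R : realType} (eps beta delta C' : R)
    (u : R * R -> R) : Prop :=
  forall i j : nat, (i + j <= 2)%N -> forall z, Omega z ->
    `|Dxy i j u z| <=
      C' * (1 + eps `^ (- i%:R) * expR (- (beta * z.1 / eps))
            + eps `^ (- (j%:R / 2)) * Elayer eps delta z.2
            + eps `^ (- (i%:R + j%:R / 2)) * expR (- (beta * z.1 / eps))
              * Elayer eps delta z.2).

(* Graded nodes, uniform with step h * s up to index ceil(1/h) and geometric
   afterwards (s = eps in x, s = sqrt eps in y), before truncation at L. *)
Fixpoint dl_node {R : realType} (h s : R) (i : nat) : R :=
  if i is k.+1 then
    if (k < `|Num.ceil h^-1|)%N then k.+1%:R * h * s
    else dl_node h s k + h * dl_node h s k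
  else 0.

(* m is the index of the end point L (M_x with L = 1, M_y with L = 1/2). *)
Definition dl_last {R : realType} (h s L : R) (m : nat) : Prop :=
  dl_node h s m.-1 < L <= (1 + h) * dl_node h s m.-1.

(* Number of intervals left once the last inner node is dropped if the last
   interval is shorter than kappa times the previous one. *)
Definition dl_size {R : realType} (kappa h s L : R) (m : nat) : nat :=
  if kappa * (dl_node h s m.-1 - dl_node h s m.-2) <= L - dl_node h s m.-1
  then m else m.-1.

Definition dl_x {R : realType} (h eps : R) (nx i : nat) : R :=
  if (i < nx)%N then dl_node h eps i else 1.

(* ny is the number of intervals of the mesh of [0, 1/2]. *)
Definition dl_y {R : realType} (h eps : R) (ny j : nat) : R :=
  if (j < ny)%N then dl_node h (Num.sqrt eps) j
  else if j == ny then 2^-1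
  else 1 - dl_node h (Num.sqrt eps) (2 * ny - j)%N.

Definition cell {R : realType} (X Y : nat -> R) (i j : nat) : set (R * R) :=
  [set z | X i <= z.1 <= X i.+1 /\ Y j <= z.2 <= Y j.+1].

(* uI is the piecewise bilinear nodal interpolant of u on the tensor mesh
   (X_i)_(i <= nx) x (Y_j)_(j <= ny); this determines uI on its cells. *)
Definition bilinear_interpolant {R : realType} (X : nat -> R) (nx : nat)
    (Y : nat -> R) (ny : nat) (u uI : R * R -> R) : Prop :=
  (forall i j, (i <= nx)%N -> (j <= ny)%N -> uI (X i, Y j) = u (X i, Y j)) /\
  (forall i j, (i < nx)%N -> (j < ny)%N ->
     exists a0 a1 a2 a3 : R, forall z, cell X Y i j z ->
       uI z = a0 + a1 * z.1 + a2 * z.2 + a3 * (z.1 * z.2)).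

(* Streamline diffusion parameter of the cell with lower left corner (x, y). *)
Definition sd_param {R : realType} (eps c1 c2 r1 r2 r3 x y : R) : R :=
  if x < c1 * eps * `|ln eps| then r1
  else if (y < c2 * Num.sqrt eps * `|ln eps|)
          || (1 - c2 * Num.sqrt eps * `|ln eps| < y) then r2
  else r3.

Definition eps_norm_sq {R : realType} (eps : R) (v : R * R -> R) : \bar R :=
  (eps%:E * \int[mu2 R]_(z in Omega) ((Dx v z) ^+ 2 + (Dy v z) ^+ 2)%:E
   + L2sq Omega v)%E.

(* For v continuous and C^1 on the open cells, Dx v and Dy v represent the weak
   gradient: the mesh lines form a null set. *)
Definition SD_norm {R : realType} (eps : R) (b : R * R -> R)
    (rho : nat -> nat -> R) (X : nat -> R) (nx : nat) (Y : nat -> R) (ny : nat)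
    (v : R * R -> R) : \bar R :=
  ((eps_norm_sq eps v +
    \sum_(i < nx) \sum_(j < ny)
      (rho i j)%:E * L2sq (cell X Y i j) (fun z => (b z * Dx v z)%R))
   `^ (2^-1)%R)%E.

(* Main.v *)
(** Every mesh step is at most [3 * h] times (layer width + distance of the cell
    to the layer), so a step absorbs one negative power of [eps] (in x) or of
    [sqrt eps] (in y) of the derivative bounds, because [(1 + t) * exp (- a t)]
    is bounded.  On each cell the mean value theorem then gives, pointwise,
    [|u - uI| <= C h], [|Dy (u - uI)| <= C h / sqrt eps] and
    [|Dx (u - uI)| <= C h (1 + w / eps)] with [w] the value of
    [(1 + x / eps) exp (- beta x / eps)] at the left end of the cell.
    The sum of [w ^+ 2] times the step telescopes against [1 / (1 + x / eps)] and
    is [O(eps)], which settles the energy norm and the part of the streamline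
    term in Omega_1.  Outside Omega_1, [w = O(eps)], and the weight
    [eps `^ (- 1/4)] on Omega_2 is compensated by the width
    [O(sqrt eps * |ln eps|)] of the two strips.  The bound on [h] follows from
    [(1 + h) ^ k >= exp (k h / 2)], which limits the number of graded nodes. *)

Require Import Defs.
From mathcomp Require Import all_boot all_order all_algebra.
From mathcomp Require Import all_classical all_reals all_analysis.
From mathcomp Require Import measurable_realfun zify ring lra.

Set Implicit Arguments.
Unset Strict Implicit.
Unset Printing Implicit Defensive.

Import Order.TTheory GRing.Theory Num.Theory.
Import numFieldNormedType.Exports.
Local Open Scope classical_set_scope.
Local Open Scope ring_scope.

(** * Integrals bounded box by box *)

(* Unlike [ge0_le_integral], this does not ask [f] to be measurable: the partial
   derivatives of the error are junk values on the mesh lines. *)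
Lemma ge0_le_integral_nonmeasurable d (T : measurableType d) (R : realType)
    (mu : {measure set T -> \bar R}) (D : set T) (f g : T -> \bar R) :
  (forall x, D x -> 0 <= f x)%E -> (forall x, D x -> f x <= g x)%E ->
  (\int[mu]_(x in D) f x <= \int[mu]_(x in D) g x)%E.
Proof.
move=> f0 fg.
rewrite !ge0_integralE//; last by move=> x Dx; exact: le_trans (f0 _ Dx) (fg _ Dx).
apply: ereal_sup_le => _ [h hf <-]; exists h => // x.
apply: le_trans (hf x) _.
by apply: lee_restrict.
Qed.

Definition box {R : realType} (a b c d : R) : set (R * R) :=
  [set z | a < z.1 < b /\ c < z.2 < d].

Definition rect {R : realType} (a b c d : R) : set (R * R) :=
  [set z | a <= z.1 <= b /\ c <= z.2 <= d].

Lemma boxE (R : realType) (a b c d : R) :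
  box a b c d = `]a, b[%classic `*` `]c, d[%classic.
Proof. by apply/seteqP; split=> z /=; rewrite !in_itv. Qed.

Lemma measurable_box (R : realType) (a b c d : R) : measurable (box a b c d).
Proof. by rewrite boxE; apply: measurableX; exact: measurable_itv. Qed.

Lemma measurable_rect (R : realType) (a b c d : R) : measurable (rect a b c d).
Proof.
rewrite (_ : rect a b c d = `[a, b]%classic `*` `[c, d]%classic).
  by apply: measurableX; exact: measurable_itv.
by apply/seteqP; split=> z /=; rewrite !in_itv.
Qed.

Lemma mu2X (R : realType) (A B : set R) : measurable A -> measurable B ->
  mu2 R (A `*` B) = (lebesgue_measure A * lebesgue_measure B)%E.
Proof.
exact: (@product_measure1E _ _ _ _ _ (@lebesgue_measure R) (@lebesgue_measure R)).
Qed.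

Lemma mu2_box (R : realType) (a b c d : R) : a <= b -> c <= d ->
  mu2 R (box a b c d) = ((b - a) * (d - c))%:E.
Proof.
move=> ab cd; rewrite boxE mu2X; try exact: measurable_itv.
have m (x y : R) : x <= y -> lebesgue_measure `]x, y[%classic = (y - x)%:E.
  rewrite lebesgue_measure_itv/= lte_fin le_eqVlt => /predU1P[->|->].
    by rewrite ltxx subrr.
  by rewrite EFinB.
by rewrite !m// EFinM.
Qed.

Lemma ae_fst_neq (R : realType) (a : R) : {ae mu2 R, forall z, z.1 <> a}.
Proof.
exists ([set a] `*` setT); split.
- by apply: measurableX.
- by rewrite mu2X// lebesgue_measure_set1 mul0e.
- by move=> z /= /contrapT.
Qed.

Lemma ae_snd_neq (R : realType) (a : R) : {ae mu2 R, forall z, z.2 <> a}.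
Proof.
exists (setT `*` [set a]); split.
- by apply: measurableX.
- by rewrite mu2X// lebesgue_measure_set1 mule0.
- by move=> z /= /contrapT.
Qed.

(** Off a null set, [g] is dominated by the sum of the [B i] times the indicators of the boxes, and
    only this measurable sum is integrated. The covering box is given by its position in [s], for
    every default [i0], so that [I] need not be inhabited. *)
Lemma integral_le_boxes (R : realType) (I : Type) (s : seq I)
    (a b c d B : I -> R) (D : set (R * R)) (g : R * R -> \bar R) :
  measurable D ->
  (forall i, a i <= b i) -> (forall i, c i <= d i) -> (forall i, 0 <= B i) ->
  (forall z, D z -> 0 <= g z)%E ->
  {ae mu2 R, forall z, D z -> exists2 k, (k < size s)%N &
     forall i0 : I, let i := nth i0 s k in
       box (a i) (b i) (c i) (d i) z /\ (g z <= (B i)%:E)%E} ->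
  (\int[mu2 R]_(z in D) g z <=
     (\sum_(i <- s) B i * ((b i - a i) * (d i - c i)))%:E)%E.
Proof.
move=> mD ab cd B0 g0 [N [mN N0 sN]].
pose h (z : R * R) : \bar R :=
  (\sum_(i <- s) (B i)%:E * (\1_(box (a i) (b i) (c i) (d i)) z)%:E)%E.
have h0 i z : (0 <= (B i)%:E * (\1_(box (a i) (b i) (c i) (d i)) z)%:E)%E.
  by rewrite mule_ge0// lee_fin.
have mh i : measurable_fun D
    (fun z => (B i)%:E * (\1_(box (a i) (b i) (c i) (d i)) z)%:E)%E.
  apply: measurable_funeM; apply/measurable_EFinP.
  exact: measurable_indic (measurable_box _ _ _ _).
(* The value +oo on the null set N makes the majorant G valid everywhere. *)
pose G z : \bar R := (h z + +oo * (\1_N z)%:E)%E.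
have mG2 : measurable_fun D (fun z => +oo * (\1_N z)%:E : \bar R)%E.
  apply: measurable_funeM; apply/measurable_EFinP.
  exact: measurable_indic.
have h0' z : (0 <= h z)%E by apply: sume_ge0 => i _; exact: h0.
have G20 z : (0 <= +oo * (\1_N z)%:E :> \bar R)%E by rewrite mule_ge0// lee_fin.
apply: (@le_trans _ _ (\int[mu2 R]_(z in D) G z)%E).
  apply: ge0_le_integral_nonmeasurable => // z Dz.
  rewrite /G; have [Nz|Nz] := pselect (N z).
    rewrite indicE mem_set//= mule1 addey ?leey//.
    by rewrite -ltNye (lt_le_trans _ (h0' z)) ?ltNy0.
  rewrite indicE memNset//= mule0 adde0.
  have : exists2 k, (k < size s)%N &
     forall i0 : I, let i := nth i0 s k in
       box (a i) (b i) (c i) (d i) z /\ (g z <= (B i)%:E)%E.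
    by apply: contrapT => H; apply: Nz; apply: sN => /= /(_ Dz)/H.
  move=> [k ks H].
  have [i0] : inhabited I by move: ks; case: (s) => // i0 *; constructor.
  have [Hb gB] := H i0.
  apply: le_trans gB _; rewrite /h (big_nth i0) big_mkord.
  rewrite (bigD1 (Ordinal ks))//= indicE mem_set//= mule1 leeDl//.
  by apply: sume_ge0 => j _; exact: h0.
rewrite /G ge0_integralD//; last by apply: emeasurable_sum => i; exact: mh.
rewrite /h ge0_integral_sum// ge0_integralZl//; last first.
  by apply/measurable_EFinP; exact: measurable_indic.
rewrite integral_indic//.
have ND0 : mu2 R (N `&` D) = 0%E.
  apply: (@subset_measure0 _ _ _ _ _ N _ _ _ N0) => //.
  by apply: measurableI; [exact: mN|exact: mD].
rewrite [X in (_ + +oo * X)%E]ND0 mule0 adde0 -sumEFin; apply: lee_sum => i _.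
rewrite ge0_integralZl//; last 2 first.
- by apply/measurable_EFinP; exact: measurable_indic (measurable_box _ _ _ _).
- by rewrite lee_fin.
rewrite integral_indic//; last exact: measurable_box.
rewrite EFinM lee_wpmul2l ?lee_fin//.
rewrite -mu2_box//; apply: le_measure; rewrite ?inE.
- by apply: measurableI => //; exact: measurable_box.
- exact: measurable_box.
- exact: subIsetl.
Qed.

(** * Mean value estimates on a cell *)

Lemma derive1_sub_affine (R : realType) (g : R -> R) (p q t : R) :
  derivable g t 1 ->
  derivable (fun s => g s - (p + q * s)) t 1 /\
  derive1 (fun s => g s - (p + q * s)) t = derive1 g t - q.
Proof.
move=> gt.
have [d2 v2] : is_derive t 1 (cst p + q *: (id : R -> R^o)) (0 + q *: (1 : R^o)).
  exact: is_deriveD.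
have {}d2 : derivable (fun s : R => p + q * s) t 1 := d2.
have {}v2 : 'D_1 (fun s : R => p + q * s) t = q.
  by rewrite -[RHS]mulr1 -[RHS]add0r; exact: v2.
split; first exact: derivableB.
by rewrite derive1E deriveB// v2 -derive1E.
Qed.

Lemma lipschitz_itv (R : realType) (g : R -> R) (a b L : R) :
  (forall t, a < t < b -> derivable g t 1 /\ `|derive1 g t| <= L) ->
  forall s t, a < s < b -> a < t < b -> `|g s - g t| <= L * `|s - t|.
Proof.
move=> H.
have main s t : s <= t -> a < s < b -> a < t < b -> `|g s - g t| <= L * `|s - t|.
  move=> st /andP[as_ sb] /andP[at_ tb].
  have st_ab x : x \in `[s, t] -> a < x < b.
    by rewrite in_itv/= => /andP[sx xt]; rewrite (lt_le_trans as_)//= (le_lt_trans xt).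
  have [x xst||c cst gE] := @MVT_segment R g (derive1 g) s t st.
  - have /H[dx _] : a < x < b by apply: st_ab; exact: subset_itv_oo_cc xst.
    by rewrite derive1E; exact/derivableP.
  - by apply: derivable_within_continuous => x /st_ab/H[].
  - by rewrite distrC gE normrM (distrC s) ler_wpM2r// (H _ (st_ab _ cst)).2.
move=> s t hs ht; have [st|/ltW ts] := leP s t; first exact: main.
by rewrite distrC (distrC s); exact: main.
Qed.

(* The difference quotients in x are compared at two heights through [Dx (Dy v)],
   so that no symmetry of the mixed derivatives is needed. *)
Lemma mixed_difference (R : realType) (a b c d Q : R) (v : R * R -> R) :
  (forall z, box a b c d z -> derivable (fun t => v (z.1, t)) z.2 1) ->
  (forall z, box a b c d z -> derivable (fun t => Dy v (t, z.2)) z.1 1) ->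
  (forall z, box a b c d z -> `|Dx (Dy v) z| <= Q) ->
  forall x x' y y', a < x < b -> a < x' < b -> c < y < d -> c < y' < d ->
    `|(v (x', y') - v (x, y')) - (v (x', y) - v (x, y))|
      <= Q * `|x' - x| * `|y' - y|.
Proof.
move=> vy vyx vQ x x' y y' hx hx' hy hy'.
apply: (@lipschitz_itv _ (fun t => v (x', t) - v (x, t)) c d) => // t ht.
have d1 : derivable (fun s => v (x', s)) t 1 := vy (x', t) (conj hx' ht).
have d2 : derivable (fun s => v (x, s)) t 1 := vy (x, t) (conj hx ht).
split; first exact: derivableB.
rewrite derive1E deriveB// -!derive1E -/(Dy v (x', t)) -/(Dy v (x, t)).
apply: (@lipschitz_itv _ (fun s => Dy v (s, t)) a b) => // s hs.
by split; [exact: vyx (s, t) (conj hs ht)|exact: vQ (s, t) (conj hs ht)].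
Qed.

(* The homothety of centre [m] and ratio [1 - t]: it moves a closed rectangle into
   the open box and preserves horizontal and vertical segments. *)
Definition shrink {R : realType} (m p : R * R) (t : R) : R * R :=
  (p.1 + t * (m.1 - p.1), p.2 + t * (m.2 - p.2)).

Lemma shrink_itv (R : realType) (a b m p t : R) : a < m < b -> a <= p <= b ->
  0 < t < 1 -> a < p + t * (m - p) < b.
Proof.
move=> /andP[am mb] /andP[ap pb] /andP[t0 t1]; apply/andP; split.
  rewrite -subr_gt0 (_ : _ - _ = (1 - t) * (p - a) + t * (m - a)); last by ring.
  by rewrite ltr_wpDl// ?mulr_ge0 ?mulr_gt0// ?subr_ge0 ?subr_gt0// ltW.
rewrite -subr_gt0 (_ : _ - _ = (1 - t) * (b - p) + t * (b - m)); last by ring.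
by rewrite ltr_wpDl// ?mulr_ge0 ?mulr_gt0// ?subr_ge0 ?subr_gt0// ltW.
Qed.

Lemma shrink_box (R : realType) (a b c d : R) (m p : R * R) (t : R) :
  box a b c d m -> rect a b c d p -> 0 < t < 1 -> box a b c d (shrink m p t).
Proof. by move=> [m1 m2] [p1 p2] t01; split; exact: shrink_itv. Qed.

Lemma box_rect (R : realType) (a b c d : R) : box a b c d `<=` rect a b c d.
Proof.
by move=> z [/andP[/ltW ? /ltW ?] /andP[/ltW ? /ltW ?]]; split; apply/andP.
Qed.

Lemma near_0_1 (R : realType) : \forall t \near (0 : R)^'+, 0 < t < 1.
Proof.
near=> t; apply/andP; split; near: t; first exact: nbhs_right_gt.
exact: nbhs_right_lt.
Unshelve. all: by end_near. Qed.

Lemma cvg_shrink (R : realType) (a b c d : R) (m p : R * R) (w : R * R -> R) :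
  {within rect a b c d, continuous w} -> box a b c d m -> rect a b c d p ->
  w (shrink m p t) @[t --> 0^'+] --> w p.
Proof.
move=> /subspace_continuousP/(_ p) wc mB pB.
apply: cvg_comp (wc pB) => S /= wS.
have sp : shrink m p t @[t --> 0^'+] --> p.
  apply: cvg_at_right_filter.
  rewrite [X in _ --> X](_ : p = shrink m p 0); last first.
    by rewrite /shrink !mul0r !addr0; case: (p).
  have e (x y : R) : x + t * y @[t --> (0 : R)] --> x + 0 * y.
    by apply: cvgD; [exact: cvg_cst|apply: cvgM; [exact: cvg_id|exact: cvg_cst]].
  exact: (cvg_pair (e _ _) (e _ _)).
have := sp _ wS; apply: filterS2 (near_0_1 R) => t t01; apply.
exact/box_rect/shrink_box.
Qed.

(** The derivatives are controlled only inside the open box, whereas the interpolation nodes are its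
    corners. Both points are shrunk into the box, and the bound passes to the limit [t -> 0+] by
    continuity on the closed rectangle. *)
Lemma rect_dist_le (R : realType) (a b c d K : R) (m p q : R * R) (w : R * R -> R) :
  {within rect a b c d, continuous w} ->
  box a b c d m -> rect a b c d p -> rect a b c d q ->
  (forall t, 0 < t < 1 -> `|w (shrink m p t) - w (shrink m q t)| <= K) ->
  `|w p - w q| <= K.
Proof.
move=> wc mB pB qB H.
have : `|w (shrink m p t) - w (shrink m q t)| @[t --> 0^'+] --> `|w p - w q|.
  by apply: cvg_norm; apply: cvgB; exact: cvg_shrink.
by move/cvgr_to_le; apply; apply: filterS (near_0_1 R).
Qed.

Lemma Ck_subset (R : realType) (k : nat) (A B : set (R * R)) (v : R * R -> R) :
  A `<=` B -> Ck k B v -> Ck k A v.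
Proof.
move=> AB; elim: k v => [|k IH] v [vc]; first by split=> // z /AB/vc.
move=> [vx vy vDx vDy]; split; first by move=> z /AB/vc.
by split=> [z /AB/vx|z /AB/vy||] //; exact: IH.
Qed.

Lemma Ck2P (R : realType) (A : set (R * R)) (v : R * R -> R) : Ck 2 A v ->
  [/\ forall z, A z -> derivable (fun t => v (t, z.2)) z.1 1,
      forall z, A z -> derivable (fun t => v (z.1, t)) z.2 1,
      forall z, A z -> derivable (fun t => Dx v (t, z.2)) z.1 1,
      forall z, A z -> derivable (fun t => Dy v (t, z.2)) z.1 1
    & forall z, A z -> derivable (fun t => Dy v (z.1, t)) z.2 1].
Proof. by move=> [_ [h1 h2 [_ [h3 _ _ _]] [_ [h4 h5 _ _]]]]. Qed.

Lemma dist_itv (R : realType) (a b s t : R) : a < s < b -> a < t < b ->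
  `|s - t| <= b - a.
Proof. by move=> /andP[? ?] /andP[? ?]; rewrite ler_norml; lra. Qed.

Section cell.
Variables (R : realType) (a b c d : R) (u : R * R -> R) (m : R * R).
Hypothesis mB : box a b c d m.
Hypothesis uc : {within rect a b c d, continuous u}.
Hypothesis u2 : Ck 2 (box a b c d) u.

Let ab : 0 <= b - a.
Proof. by case: mB => /andP[? ?] _; lra. Qed.

Let cd : 0 <= d - c.
Proof. by case: mB => _ /andP[? ?]; lra. Qed.

Lemma value_dist (P Q : R) (p q : R * R) :
  (forall z, box a b c d z -> `|Dx u z| <= P) ->
  (forall z, box a b c d z -> `|Dy u z| <= Q) ->
  rect a b c d p -> rect a b c d q ->
  `|u p - u q| <= (b - a) * P + (d - c) * Q.
Proof.
have [ux uy _ _ _] := Ck2P u2.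
move=> uP uQ pB qB; apply: (rect_dist_le uc mB) => // t t01.
have [p1 p2] := shrink_box mB pB t01; have [q1 q2] := shrink_box mB qB t01.
move: (shrink m p t) (shrink m q t) p1 p2 q1 q2 => [x y] [x' y']/= hx hy hx' hy'.
have P0 : 0 <= P := le_trans (normr_ge0 _) (uP _ mB).
have Q0 : 0 <= Q := le_trans (normr_ge0 _) (uQ _ mB).
(* The path turns at [(x', y)], so each leg is parallel to an axis and stays in the box. *)
rewrite (_ : _ - _ = (u (x, y) - u (x', y)) + (u (x', y) - u (x', y'))); last by ring.
apply: le_trans (ler_normD _ _) _; apply: lerD.
  have := @lipschitz_itv _ (fun s => u (s, y)) a b P _ x x' hx hx'.
  move=> /(_ (fun s hs => conj (ux (s, y) (conj hs hy)) (uP (s, y) (conj hs hy)))).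
  by move/le_trans; apply; rewrite mulrC ler_wpM2r// dist_itv.
have := @lipschitz_itv _ (fun s => u (x', s)) c d Q _ y y' hy hy'.
move=> /(_ (fun s hs => conj (uy (x', s) (conj hx' hs)) (uQ (x', s) (conj hx' hs)))).
by move/le_trans; apply; rewrite mulrC ler_wpM2r// dist_itv.
Qed.

(** On the horizontal line through [z], the difference between [u] and its tangent at [z] has slope
    at most [(b - a) * P]; moving the increment of [u] from height [z.2] to height [y] costs
    [(d - c) * Q] per unit length, by [mixed_difference]. *)
Lemma slope_x (P Q : R) (z : R * R) (y : R) :
  (forall z, box a b c d z -> `|Dx (Dx u) z| <= P) ->
  (forall z, box a b c d z -> `|Dx (Dy u) z| <= Q) ->
  box a b c d z -> c <= y <= d ->
  `|Dx u z * (b - a) - (u (b, y) - u (a, y))|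
    <= (b - a) * ((b - a) * P + (d - c) * Q).
Proof.
have [ux uy uxx uyx _] := Ck2P u2.
move=> uP uQ zB hy.
have P0 : 0 <= P := le_trans (normr_ge0 _) (uP _ mB).
have Q0 : 0 <= Q := le_trans (normr_ge0 _) (uQ _ mB).
(* A bound on the increments of w in the open box passes to the closed edges. *)
pose w (q : R * R) := Dx u z * q.1 - u q.
rewrite (_ : _ - _ = w (b, y) - w (a, y)); last by rewrite /w/=; ring.
apply: (rect_dist_le _ mB).
- apply/subspace_continuousP => q qB.
  apply: cvgB; last by move/subspace_continuousP: uc; apply.
  apply: cvgM; first exact: cvg_cst.
  by apply: cvg_within_filter; exact: cvg_fst.
- by split=> //=; rewrite lexx ?andbT -subr_ge0.
- by split=> //=; rewrite lexx ?andbT -subr_ge0.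
move=> t t01; set x1 := b + t * (m.1 - b); set x0 := a + t * (m.1 - a).
have hx1 : a < x1 < b by apply: shrink_itv => //;
  [exact: mB.1|rewrite lexx ?andbT -subr_ge0].
have hx0 : a < x0 < b by apply: shrink_itv => //;
  [exact: mB.1|rewrite lexx ?andbT -subr_ge0].
have hy' : c < y + t * (m.2 - y) < d by apply: shrink_itv => //; exact: mB.2.
rewrite /shrink/= -/x1 -/x0; move: (y + _) hy' => y' hy'.
have -> : w (x1, y') - w (x0, y') =
    ((Dx u z * x1 - u (x1, z.2)) - (Dx u z * x0 - u (x0, z.2)))
    - ((u (x1, y') - u (x0, y')) - (u (x1, z.2) - u (x0, z.2))).
  by rewrite /w/=; ring.
have M : `|(u (x1, y') - u (x0, y')) - (u (x1, z.2) - u (x0, z.2))|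
    <= (b - a) * ((d - c) * Q).
  apply: le_trans (mixed_difference uy uyx uQ hx0 hx1 zB.2 hy') _.
  rewrite [leRHS](_ : _ = Q * (b - a) * (d - c)); last by ring.
  apply: ler_pM; rewrite ?mulr_ge0 ?ler_wpM2l ?dist_itv//; exact: zB.2.
have L : `|(Dx u z * x1 - u (x1, z.2)) - (Dx u z * x0 - u (x0, z.2))|
    <= (b - a) * ((b - a) * P).
  rewrite (_ : _ - _ = (u (x0, z.2) - (0 + Dx u z * x0)) -
    (u (x1, z.2) - (0 + Dx u z * x1))); last by ring.
  apply: le_trans (@lipschitz_itv _ (fun s => u (s, z.2) - (0 + Dx u z * s)) a b
    ((b - a) * P) _ _ _ hx0 hx1) _ => [s hs|]; last first.
    by rewrite mulrC ler_wpM2r ?mulr_ge0// dist_itv.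
  have [d1 ->] := derive1_sub_affine 0 (Dx u z) (ux (s, z.2) (conj hs zB.2)).
  split=> //; rewrite -/(Dx u (s, z.2)).
  apply: le_trans (@lipschitz_itv _ (fun r => Dx u (r, z.2)) a b P _ _ _ hs zB.1) _.
    move=> r hr; split; first exact: (uxx (r, z.2) (conj hr zB.2)).
    exact: (uP (r, z.2) (conj hr zB.2)).
  by rewrite mulrC ler_wpM2r// dist_itv//; exact: zB.1.
by apply: le_trans (ler_normB _ _) _; rewrite [leRHS]mulrDr lerD.
Qed.

(** The mixed second difference is unchanged when the two variables exchange roles, so the same
    derivative [Dx (Dy u)] as in [slope_x] serves here. *)
Lemma slope_y (P Q : R) (z : R * R) (x : R) :
  (forall z, box a b c d z -> `|Dy (Dy u) z| <= P) ->
  (forall z, box a b c d z -> `|Dx (Dy u) z| <= Q) ->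
  box a b c d z -> a <= x <= b ->
  `|Dy u z * (d - c) - (u (x, d) - u (x, c))|
    <= (d - c) * ((d - c) * P + (b - a) * Q).
Proof.
have [ux uy uxx uyx uyy] := Ck2P u2.
move=> uP uQ zB hx.
have P0 : 0 <= P := le_trans (normr_ge0 _) (uP _ mB).
have Q0 : 0 <= Q := le_trans (normr_ge0 _) (uQ _ mB).
pose w (q : R * R) := Dy u z * q.2 - u q.
rewrite (_ : _ - _ = w (x, d) - w (x, c)); last by rewrite /w/=; ring.
apply: (rect_dist_le _ mB).
- apply/subspace_continuousP => q qB.
  apply: cvgB; last by move/subspace_continuousP: uc; apply.
  apply: cvgM; first exact: cvg_cst.
  by apply: cvg_within_filter; exact: cvg_snd.
- by split=> //=; rewrite lexx ?andbT -subr_ge0.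
- by split=> //=; rewrite lexx ?andbT -subr_ge0.
move=> t t01; set y1 := d + t * (m.2 - d); set y0 := c + t * (m.2 - c).
have hy1 : c < y1 < d by apply: shrink_itv => //;
  [exact: mB.2|rewrite lexx ?andbT -subr_ge0].
have hy0 : c < y0 < d by apply: shrink_itv => //;
  [exact: mB.2|rewrite lexx ?andbT -subr_ge0].
have hx' : a < x + t * (m.1 - x) < b by apply: shrink_itv => //; exact: mB.1.
rewrite /shrink/= -/y1 -/y0; move: (x + _) hx' => x' hx'.
have -> : w (x', y1) - w (x', y0) =
    ((Dy u z * y1 - u (z.1, y1)) - (Dy u z * y0 - u (z.1, y0)))
    - ((u (x', y1) - u (z.1, y1)) - (u (x', y0) - u (z.1, y0))).
  by rewrite /w/=; ring.
have M : `|(u (x', y1) - u (z.1, y1)) - (u (x', y0) - u (z.1, y0))|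
    <= (d - c) * ((b - a) * Q).
  apply: le_trans (mixed_difference uy uyx uQ zB.1 hx' hy0 hy1) _.
  rewrite [leRHS](_ : _ = Q * (b - a) * (d - c)); last by ring.
  apply: ler_pM; rewrite ?mulr_ge0 ?ler_wpM2l ?dist_itv//; exact: zB.1.
have L : `|(Dy u z * y1 - u (z.1, y1)) - (Dy u z * y0 - u (z.1, y0))|
    <= (d - c) * ((d - c) * P).
  rewrite (_ : _ - _ = (u (z.1, y0) - (0 + Dy u z * y0)) -
    (u (z.1, y1) - (0 + Dy u z * y1))); last by ring.
  apply: le_trans (@lipschitz_itv _ (fun s => u (z.1, s) - (0 + Dy u z * s)) c d
    ((d - c) * P) _ _ _ hy0 hy1) _ => [s hs|]; last first.
    by rewrite mulrC ler_wpM2r ?mulr_ge0// dist_itv.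
  have [d1 ->] := derive1_sub_affine 0 (Dy u z) (uy (z.1, s) (conj zB.1 hs)).
  split=> //; rewrite -/(Dy u (z.1, s)).
  apply: le_trans (@lipschitz_itv _ (fun r => Dy u (z.1, r)) c d P _ _ _ hs zB.2) _.
    move=> r hr; split; first exact: (uyy (z.1, r) (conj zB.1 hr)).
    exact: (uP (z.1, r) (conj zB.1 hr)).
  by rewrite mulrC ler_wpM2r// dist_itv//; exact: zB.2.
by apply: le_trans (ler_normB _ _) _; rewrite [leRHS]mulrDr lerD.
Qed.

End cell.

(** * Bilinear interpolation on a cell *)

(** A bilinear function is affine in each variable, so one application per variable carries bounds
    from the corners to the whole cell. *)
Lemma affine_norm_le (R : realType) (p q a b K x : R) : a < b -> a <= x <= b ->
  `|p + q * a| <= K -> `|p + q * b| <= K -> `|p + q * x| <= K.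
Proof.
move=> ab /andP[ax xb] Ka Kb; rewrite -(@ler_pM2r _ (b - a)) ?subr_gt0//.
rewrite -{1}(@gtr0_norm _ (b - a)) ?subr_gt0// -normrM.
rewrite (_ : (p + q * x) * (b - a) = (p + q * a) * (b - x) + (p + q * b) * (x - a)); last by ring.
rewrite (_ : K * _ = K * (b - x) + K * (x - a)); last by ring.
apply: le_trans (ler_normD _ _) _; rewrite !normrM.
by rewrite (ger0_norm (_ : 0 <= b - x)) ?(ger0_norm (_ : 0 <= x - a)) ?subr_ge0//
  lerD// ler_wpM2r// subr_ge0.
Qed.

Section interpolation.
Variables (R : realType) (a b c d : R) (u uI : R * R -> R) (z : R * R).
Hypothesis zB : box a b c d z.
Hypothesis uc : {within rect a b c d, continuous u}.
Hypothesis u2 : Ck 2 (box a b c d) u.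
Variables a0 a1 a2 a3 : R.
Hypothesis uIE : forall z, rect a b c d z ->
  uI z = a0 + a1 * z.1 + a2 * z.2 + a3 * (z.1 * z.2).
Hypotheses (uIac : uI (a, c) = u (a, c)) (uIad : uI (a, d) = u (a, d))
  (uIbc : uI (b, c) = u (b, c)) (uIbd : uI (b, d) = u (b, d)).

Let ab : a < b.
Proof. by case: zB => /andP[/lt_trans az /az]. Qed.

Let cd : c < d.
Proof. by case: zB => _ /andP[/lt_trans cz /cz]. Qed.

Let xab : a <= z.1 <= b.
Proof. by have [] := box_rect zB. Qed.

Let ycd : c <= z.2 <= d.
Proof. by have [] := box_rect zB. Qed.

Let rect_corner x y : x \in [:: a; b] -> y \in [:: c; d] -> rect a b c d (x, y).
Proof.
rewrite !inE => /orP[]/eqP-> /orP[]/eqP->; split=> /=;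
  by rewrite lexx ?andbT ltW.
Qed.

(** With [u z] frozen, [uI - u z] is bilinear, hence largest in modulus at a corner; there [uI]
    equals [u], and [value_dist] compares two values of [u]. *)
Lemma interpolation_value (P Q : R) :
  (forall z, box a b c d z -> `|Dx u z| <= P) ->
  (forall z, box a b c d z -> `|Dy u z| <= Q) ->
  `|u z - uI z| <= (b - a) * P + (d - c) * Q.
Proof.
move=> uP uQ; set K := (X in _ <= X); rewrite distrC uIE; last exact: box_rect.
have E x y : x \in [:: a; b] -> y \in [:: c; d] -> u (x, y) = uI (x, y) ->
    `|a0 + a1 * x + a2 * y + a3 * (x * y) - u z| <= K.
  move=> hx hy; rewrite uIE; last exact: rect_corner.
  move=> /= <-; apply: (value_dist zB uc u2 uP uQ); last exact: box_rect.
  exact: rect_corner.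
rewrite (_ : _ - _ = (a0 + a1 * z.1 - u z) + (a2 + a3 * z.1) * z.2); last by ring.
apply: (affine_norm_le cd ycd).
  rewrite (_ : _ + _ = (a0 + a2 * c - u z) + (a1 + a3 * c) * z.1); last by ring.
  apply: (affine_norm_le ab xab).
    by apply: le_trans (E a c _ _ _); rewrite ?inE ?eqxx ?orbT// le_eqVlt;
      apply/orP; left; apply/eqP; congr `|_|; ring.
  by apply: le_trans (E b c _ _ _); rewrite ?inE ?eqxx ?orbT// le_eqVlt;
    apply/orP; left; apply/eqP; congr `|_|; ring.
rewrite (_ : _ + _ = (a0 + a2 * d - u z) + (a1 + a3 * d) * z.1); last by ring.
apply: (affine_norm_le ab xab).
  by apply: le_trans (E a d _ _ _); rewrite ?inE ?eqxx ?orbT// le_eqVlt;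
    apply/orP; left; apply/eqP; congr `|_|; ring.
by apply: le_trans (E b d _ _ _); rewrite ?inE ?eqxx ?orbT// le_eqVlt;
  apply/orP; left; apply/eqP; congr `|_|; ring.
Qed.

(** The x-derivative of the interpolant is affine in y, so it suffices to compare [Dx u z] with its
    values on the two horizontal edges. These are difference quotients of [u], the situation of
    [slope_x]. *)
Lemma interpolation_Dx (P Q : R) :
  (forall z, box a b c d z -> `|Dx (Dx u) z| <= P) ->
  (forall z, box a b c d z -> `|Dx (Dy u) z| <= Q) ->
  `|Dx (fun z => u z - uI z) z| <= (b - a) * P + (d - c) * Q.
Proof.
move=> uP uQ; have [ux _ _ _ _] := Ck2P u2.
have -> : Dx (fun z => u z - uI z) z = - (a1 + - Dx u z + a3 * z.2).
  rewrite {1}/Dx derive1E.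
  (* [uI] is bilinear only on the cell; [g] agrees with [u - uI] near [z.1], which is all the
     derivative sees. *)
  pose g t := u (t, z.2) - (a0 + a2 * z.2 + (a1 + a3 * z.2) * t).
  rewrite (@near_eq_derive _ _ _ _ g); last first.
    have /andP[az zb] := zB.1; near=> t.
    rewrite /g uIE/=; first by ring.
    apply: box_rect; split; last exact: zB.2.
    by apply/andP; split; near: t; [exact: lt_nbhsr|exact: lt_nbhsl].
  rewrite -derive1E /g; have [_ ->] := derive1_sub_affine (a0 + a2 * z.2) (a1 + a3 * z.2) (ux z zB).
  by rewrite -/(Dx u z); ring.
rewrite normrN; set K := (X in _ <= X).
have E y : y \in [:: c; d] -> u (b, y) = uI (b, y) -> u (a, y) = uI (a, y) ->
    `|a1 + - Dx u z + a3 * y| <= K.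
  move=> hy hb ha; rewrite -(@ler_pM2l _ (b - a)) ?subr_gt0//.
  rewrite -{1}(@gtr0_norm _ (b - a)) ?subr_gt0// -normrM.
  have : c <= y <= d.
    by move: hy; rewrite !inE => /orP[]/eqP->; rewrite lexx ?andbT ltW.
  move/(slope_x zB uc u2 uP uQ zB); apply: le_trans.
  have ra : rect a b c d (a, y) by apply: rect_corner; rewrite // inE eqxx.
  have rb : rect a b c d (b, y) by apply: rect_corner; rewrite // !inE eqxx orbT.
  rewrite hb ha !uIE//=.
  by rewrite -normrN le_eqVlt; apply/orP; left; apply/eqP; congr `|_|; ring.
by apply: (affine_norm_le cd ycd); apply: E; rewrite ?inE ?eqxx ?orbT.
Unshelve. all: by end_near. Qed.

Lemma interpolation_Dy (P Q : R) :
  (forall z, box a b c d z -> `|Dy (Dy u) z| <= P) ->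
  (forall z, box a b c d z -> `|Dx (Dy u) z| <= Q) ->
  `|Dy (fun z => u z - uI z) z| <= (d - c) * P + (b - a) * Q.
Proof.
move=> uP uQ; have [_ uy _ _ _] := Ck2P u2.
have -> : Dy (fun z => u z - uI z) z = - (a2 + - Dy u z + a3 * z.1).
  rewrite {1}/Dy derive1E.
  pose g t := u (z.1, t) - (a0 + a1 * z.1 + (a2 + a3 * z.1) * t).
  rewrite (@near_eq_derive _ _ _ _ g); last first.
    have /andP[cz zd] := zB.2; near=> t.
    rewrite /g uIE/=; first by ring.
    apply: box_rect; split; first exact: zB.1.
    by apply/andP; split; near: t; [exact: lt_nbhsr|exact: lt_nbhsl].
  rewrite -derive1E /g; have [_ ->] := derive1_sub_affine (a0 + a1 * z.1) (a2 + a3 * z.1) (uy z zB).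
  by rewrite -/(Dy u z); ring.
rewrite normrN; set K := (X in _ <= X).
have E x : x \in [:: a; b] -> u (x, d) = uI (x, d) -> u (x, c) = uI (x, c) ->
    `|a2 + - Dy u z + a3 * x| <= K.
  move=> hx hd hc; rewrite -(@ler_pM2l _ (d - c)) ?subr_gt0//.
  rewrite -{1}(@gtr0_norm _ (d - c)) ?subr_gt0// -normrM.
  have : a <= x <= b.
    by move: hx; rewrite !inE => /orP[]/eqP->; rewrite lexx ?andbT ltW.
  move/(slope_y zB uc u2 uP uQ zB); apply: le_trans.
  have rc : rect a b c d (x, c) by apply: rect_corner; rewrite // inE eqxx.
  have rd : rect a b c d (x, d) by apply: rect_corner; rewrite // !inE eqxx orbT.
  rewrite hd hc !uIE//=.
  by rewrite -normrN le_eqVlt; apply/orP; left; apply/eqP; congr `|_|; ring.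
by apply: (affine_norm_le ab xab); apply: E; rewrite ?inE ?eqxx ?orbT.
Unshelve. all: by end_near. Qed.

End interpolation.

(** * The graded mesh *)

Section graded_nodes.
Variables (R : realType) (h s : R).
Hypotheses (h01 : 0 < h < 1) (s0 : 0 < s).

Let N := `|Num.ceil h^-1|%N.

Let h0 : 0 < h. Proof. by case/andP: h01. Qed.

(** Hence the uniform part of the mesh ends between [s] and [(1 + h) * s]. *)
Lemma ceil_inv_bounds : 1 <= N%:R * h /\ N%:R * h <= 1 + h.
Proof.
have c0 : 0 <= Num.ceil h^-1.
  by rewrite -(@ler0z R); apply: le_trans (ceil_ge _); rewrite invr_ge0 ltW.
have NE : N%:R = (Num.ceil h^-1)%:~R :> R.
  by rewrite -[in RHS](gez0_abs c0) pmulrn.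
rewrite NE; split.
  by rewrite -ler_pdivrMr// div1r ceil_ge.
rewrite -ler_pdivlMr// mulrDl mulfV ?gt_eqF// div1r.
have := real_ceilB1_lt (num_real h^-1); rewrite intrB; lra.
Qed.

Lemma dl_node_unif i : (i <= N)%N -> dl_node h s i = i%:R * h * s.
Proof. by case: i => [|i] iN; rewrite ?mul0r//= ifT. Qed.

Lemma dl_node_geom i : (N <= i)%N -> dl_node h s i.+1 = (1 + h) * dl_node h s i.
Proof. by move=> Ni; rewrite /= ltnNge Ni/=; ring. Qed.

Lemma dl_node_ge0 i : 0 <= dl_node h s i.
Proof.
have h0' := ltW h0; have s0' := ltW s0.
elim: i => [|i IH] //=; case: ifP => _; first by rewrite !mulr_ge0.
by rewrite addr_ge0// mulr_ge0.
Qed.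

Lemma dl_node_step i : 0 <= dl_node h s i.+1 - dl_node h s i <= h * (s + dl_node h s i).
Proof.
have n0 := dl_node_ge0 i; have hs : 0 <= h * s by rewrite mulr_ge0 ?ltW//.
have hn : 0 <= h * dl_node h s i by rewrite mulr_ge0 ?(ltW h0).
rewrite mulrDr; have [iN|Ni] := ltnP i N; last by rewrite dl_node_geom//; lra.
have e : dl_node h s i.+1 - dl_node h s i = h * s.
  by rewrite !dl_node_unif ?(ltnW iN)// -addn1 natrD; ring.
by rewrite e; lra.
Qed.

Lemma dl_node_nd i j : (i <= j)%N -> dl_node h s i <= dl_node h s j.
Proof.
move=> /subnK <-; elim: (j - i)%N => [|k IH] //; rewrite addSn.
by apply: le_trans IH _; have /andP[] := dl_node_step (k + i); rewrite subr_ge0.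
Qed.

(** This follows from [expR (- (h / 2)) >= 1 - h / 2] and from [(1 + h) * (1 - h / 2) >= 1] for [h]
    between 0 and 1. *)
Lemma expR_half_le : expR (h / 2) <= 1 + h.
Proof.
have /andP[_ h1] := h01; have := expR_ge1Dx (- (h / 2)); rewrite expRN => H.
have e0 := expR_gt0 (h / 2).
have : (1 - h / 2) * expR (h / 2) <= 1.
  by rewrite -ler_pdivlMr// div1r.
have h0' := h0; nra.
Qed.

Lemma dl_node_geom_ge k : s * expR (k%:R * (h / 2)) <= dl_node h s (N + k).
Proof.
elim: k => [|k IH].
  rewrite mul0r expR0 mulr1 addn0 dl_node_unif// ler_peMl ?(ltW s0)//.
  by case: ceil_inv_bounds.
rewrite addnS dl_node_geom ?leq_addr// -addn1 natrD mulrDl mul1r expRD mulrA mulrC.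
by rewrite ler_pM ?expR_ge0 ?mulr_ge0 ?expR_ge0 ?(ltW s0)// expR_half_le.
Qed.

(** If the last inner node is dropped, two steps merge, and [(1 + h) ^+ 2 - 1 <= 3 * h] bounds the
    new last step relative to its left end. For the count, the last inner node is at least
    [s * expR ((n - 1 - N) * h / 2)] and stays below 1, while [N * h <= 1 + h]. *)
Lemma dl_size_spec (kappa L : R) (m : nat) : L <= 1 -> 4 * s <= L ->
  dl_last h s L m ->
  let n := dl_size kappa h s L m in
  [/\ (0 < n)%N, dl_node h s n.-1 < L,
      L - dl_node h s n.-1 <= 3 * h * dl_node h s n.-1
    & n%:R * h <= 4 - 2 * ln s].
Proof.
have /andP[_ h1] := h01; have [Nh1 Nh2] := ceil_inv_bounds; have h0' := h0.
move=> L1 sL /andP[mL Lm].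
(* The last inner node lies in the graded part: otherwise it is at most [(1 + h) * s], and one more
   factor [1 + h] gives less than [4 * s <= L], against [dl_last]. *)
have Nm : (N < m.-1)%N.
  rewrite ltnNge; apply/negP => mN; have := dl_node_nd mN.
  rewrite (dl_node_unif (leqnn N)) => H.
  have : (1 + h) * dl_node h s m.-1 < L; last by rewrite ltNge Lm.
  have n0 := dl_node_ge0 m.-1.
  have : dl_node h s m.-1 <= (1 + h) * s by apply: le_trans H _; rewrite ler_pM2r.
  have s0' := s0; nra.
case: m Nm mL Lm => [|[|m]]// Nm mL Lm; set n := dl_size _ _ _ _ _.
have nE : n = m.+2 \/ n = m.+1 by rewrite /n /dl_size/=; case: ifP; [left|right].
clearbody n.
have {Nm} Nm : (N <= m)%N by [].
have mE := dl_node_geom Nm.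
have m0 := dl_node_ge0 m; have mm0 := dl_node_ge0 m.+1.
have [nL Ln] : dl_node h s n.-1 < L /\
    L - dl_node h s n.-1 <= 3 * h * dl_node h s n.-1.
  case: nE => ->; split=> //; rewrite -?[m.+2.-1]/(m.+1) -?[m.+1.-1]/m.
  - by have := mulr_ge0 (ltW h0) mm0; move: Lm; rewrite -[m.+2.-1]/m.+1; lra.
  - by apply: le_lt_trans mL; exact: dl_node_nd.
  - move: Lm; rewrite [X in _ <= _ * X](_ : _ = (1 + h) * dl_node h s m)// => Lm.
    have := mulr_ge0 (ltW h0) m0; nra.
have n0 : (0 < n)%N by case: nE => ->.
split=> //.
have Nn : (N <= n.-1)%N by case: nE => -> //=; exact: leqW.
have := dl_node_geom_ge (n.-1 - N); rewrite subnKC// => H.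
have : s * expR ((n.-1 - N)%:R * (h / 2)) < 1 by apply: le_lt_trans H _; lra.
rewrite -[X in X * expR _](@lnK _ s) ?posrE// -expRD expR_lt1.
have nn : n%:R = n.-1%:R + 1 :> R by rewrite -[in LHS](prednK n0) -addn1 natrD.
rewrite natrB// nn => H'.
have e : (n.-1%:R - N%:R) * (h / 2) = (n.-1%:R * h - N%:R * h) / 2 by field.
by rewrite e in H'; rewrite mulrDl mul1r; lra.
Qed.

(** With [s = eps] and [L = 1] this is [dl_x]; with [s = sqrt eps] and [L = 1/2] it is the lower
    half of [dl_y]. *)
Definition dl_half (L : R) (n i : nat) : R := if (i < n)%N then dl_node h s i else L.

Lemma dl_half_spec (L : R) (n i : nat) :
  dl_node h s n.-1 < L -> L - dl_node h s n.-1 <= 3 * h * dl_node h s n.-1 ->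
  (i < n)%N ->
  [/\ 0 <= dl_half L n i, dl_half L n i <= dl_half L n i.+1,
      dl_half L n i.+1 <= L
    & dl_half L n i.+1 - dl_half L n i <= 3 * h * (s + dl_half L n i)].
Proof.
move=> nL Ln iltn; rewrite /dl_half iltn.
have n0 : (0 < n)%N := leq_ltn_trans (leq0n _) iltn.
have i0 := dl_node_ge0 i; have hs : 0 <= h * s by rewrite mulr_ge0 ?ltW//.
have hi : 0 <= h * dl_node h s i by rewrite mulr_ge0 ?(ltW h0).
have [in1|] := ltnP i.+1 n.
  have /andP[st1 st2] := dl_node_step i.
  split=> //; [by rewrite -subr_ge0| |by lra].
  apply: le_trans (ltW nL); apply: dl_node_nd; by rewrite -ltnS prednK.
move=> ni; have iE : i = n.-1 by lia.
by rewrite -iE in nL Ln; split=> //; [exact: ltW|lra].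
Qed.

End graded_nodes.

Lemma itv_cover (R : realType) (X : nat -> R) (n : nat) (t : R) :
  X 0 < t -> t < X n -> (forall i, t <> X i) ->
  exists2 i, (i < n)%N & X i < t < X i.+1.
Proof.
move=> Xt + tX; elim: n => [|n IH] tn; first by have := lt_trans Xt tn; rewrite ltxx.
have [tn'|nt|e] := ltgtP t (X n).
- by have [i /ltnW iltn it] := IH tn'; exists i.
- by exists n => //; rewrite nt.
- by have := tX n e.
Qed.

Section dl_y_mesh.
Variables (R : realType) (h eps : R) (n : nat).

Lemma dl_y_half (j : nat) : (j <= n)%N ->
  dl_y h eps n j = dl_half h (Num.sqrt eps) 2^-1 n j.
Proof.
rewrite /dl_y /dl_half leq_eqVlt => /orP[/eqP->|->//].
by rewrite ltnn eqxx.
Qed.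

Lemma dl_y_sym (j : nat) : (j <= 2 * n)%N ->
  dl_y h eps n j = 1 - dl_y h eps n (2 * n - j).
Proof.
move=> jn; rewrite /dl_y.
have [jltn|njlt|->] := ltngtP j n.
- rewrite ifF; last by apply/negbTE; rewrite -leqNgt; lia.
  rewrite ifF; last by apply/eqP; lia.
  by rewrite subKn// opprD opprK addrA subrr add0r.
- by rewrite ifT//; lia.
- rewrite mul2n -addnn addnK ltnn eqxx; lra.
Qed.

(** The witness [d] is the distance of the cell to the nearer of the sides [y = 0] and [y = 1]: its
    lower end in the lower half and, by symmetry, one minus its upper end in the upper half. *)
Lemma dl_y_spec (j : nat) : 0 < h < 1 -> 0 < eps ->
  dl_node h (Num.sqrt eps) n.-1 < 2^-1 ->
  2^-1 - dl_node h (Num.sqrt eps) n.-1 <= 3 * h * dl_node h (Num.sqrt eps) n.-1 ->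
  (j < 2 * n)%N ->
  exists d, [/\ 0 <= d, d <= dl_y h eps n j,
    dl_y h eps n j <= dl_y h eps n j.+1, dl_y h eps n j.+1 <= 1 - d
  & dl_y h eps n j.+1 - dl_y h eps n j <= 3 * h * (Num.sqrt eps + d)].
Proof.
move=> h01 eps0 nL Ln jn; have s0 : 0 < Num.sqrt eps by rewrite sqrtr_gt0.
have [jltn|nj] := ltnP j n.
  have [A1 A2 A3 A4] := dl_half_spec h01 s0 nL Ln jltn.
  exists (dl_y h eps n j); rewrite !dl_y_half// ?(ltnW jltn)//.
  by split=> //; lra.
have j'n : (2 * n - j.+1 < n)%N by lia.
have [A1 A2 A3 A4] := dl_half_spec h01 s0 nL Ln j'n.
exists (dl_y h eps n (2 * n - j.+1)).
rewrite (dl_y_sym jn) (dl_y_sym (ltnW jn)).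
have -> : (2 * n - j = (2 * n - j.+1).+1)%N by lia.
rewrite !dl_y_half// ?(ltnW j'n)//.
by split=> //; lra.
Qed.

End dl_y_mesh.

(** * Layer functions *)

Lemma linear_expR_le (R : realType) (a t : R) : 0 < a -> 0 <= t ->
  (1 + t) * expR (- (a * t)) <= 1 + a^-1.
Proof.
move=> a0 t0; rewrite expRN ler_pdivrMr ?expR_gt0//.
have ai : 0 < a^-1 by rewrite invr_gt0.
apply: (@le_trans _ _ ((1 + a^-1) * (1 + a * t))); last first.
  by rewrite ler_wpM2l ?expR_ge1Dx//; lra.
have -> : (1 + a^-1) * (1 + a * t) = 1 + t + a * t + a^-1.
  by field; rewrite gt_eqF.
by have := mulr_ge0 (ltW a0) t0; lra.
Qed.

Lemma quadratic_expR_le (R : realType) (a t : R) : 0 < a -> 0 <= t ->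
  (1 + t) ^+ 2 * expR (- (a * t)) <= (1 + 2 / a) ^+ 2.
Proof.
move=> a0 t0; have -> : expR (- (a * t)) = expR (- (a / 2 * t)) ^+ 2.
  by rewrite expr2 -expRD; congr expR; field.
rewrite -exprMn (_ : 2 / a = (a / 2)^-1); last by rewrite invf_div.
rewrite lerXn2r ?nnegrE//.
- by rewrite mulr_ge0 ?expR_ge0// addr_ge0.
- by rewrite addr_ge0// invr_ge0 divr_ge0// ltW.
- by apply: linear_expR_le => //; rewrite divr_gt0.
Qed.

Lemma powR_sqrt_inv (R : realType) (eps : R) (j : nat) : 0 < eps ->
  eps `^ (- (j%:R / 2)) = (Num.sqrt eps)^-1 ^+ j.
Proof.
move=> e0; rewrite powRN mulrC powRrM powR12_sqrt ?ltW//.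
by rewrite powR_mulrn ?sqrtr_ge0// exprVn.
Qed.

Lemma powR_nat_inv (R : realType) (eps : R) (i : nat) : 0 < eps ->
  eps `^ (- i%:R) = eps^-1 ^+ i.
Proof. by move=> e0; rewrite powRN powR_mulrn ?ltW// exprVn. Qed.

(** * Derivative bounds and pointwise errors on a mesh cell *)

Section cell_bounds.
Variables (R : realType) (eps beta delta C' : R) (u : R * R -> R).
Hypotheses (eps01 : 0 < eps <= 1) (beta0 : 0 < beta) (delta0 : 0 < delta).
Hypothesis ub : derivative_bounds eps beta delta C' u.
Variables (x0 x1 y0 y1 dist : R).
Hypotheses (x0_ge0 : 0 <= x0) (x1_le1 : x1 <= 1).
Hypotheses (dist_ge0 : 0 <= dist) (dist_y0 : dist <= y0) (y1_dist : y1 <= 1 - dist).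

Let s : R := Num.sqrt eps.
Let ex : R := expR (- (beta * (x0 / eps))).
Let Ey : R := 2 * expR (- (delta * (dist / s))).

Let eps0 : 0 < eps. Proof. by case/andP: eps01. Qed.
Let s0 : 0 < s. Proof. by rewrite sqrtr_gt0. Qed.

Lemma box_Omega : box x0 x1 y0 y1 `<=` Omega.
Proof.
move=> z [/andP[z1 z2] /andP[z3 z4]].
split; rewrite (le_lt_trans _ z1, le_lt_trans _ z3)//= ?(lt_le_trans z2)//.
  by rewrite (lt_le_trans z4)// (le_trans y1_dist)// gerBl.
exact: le_trans dist_y0.
Qed.

(** The assumed bound factors into an x part and a y part. Each exponential decreases away from its
    layer, so its value at [x0], respectively at distance [dist], dominates it on the cell; the
    factor 2 in [Ey] counts the two layers in y. [C'] enters through its modulus because its sign is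
    not fixed. *)
Lemma derivative_bounds_cell (i j : nat) : (i + j <= 2)%N ->
  forall z, box x0 x1 y0 y1 z ->
  `|Dxy i j u z| <= `|C'| * (1 + eps^-1 ^+ i * ex) * (1 + s^-1 ^+ j * Ey).
Proof.
move=> ij z zB; have := ub ij (box_Omega zB).
rewrite opprD powRD ?(gt_eqF eps0) ?implybT// !powR_sqrt_inv// !powR_nat_inv// -/s.
set e1 := expR _; set E := Elayer _ _ _ => /le_trans; apply.
case: zB => /andP[z1 z2] /andP[z3 z4].
have dz : dist <= z.2 by apply: le_trans dist_y0 _; exact: ltW.
have dz' : dist <= 1 - z.2.
  by rewrite lerBrDr -lerBrDl; apply: le_trans (ltW z4) _.
have p0 : 0 <= eps^-1 ^+ i by rewrite exprn_ge0// invr_ge0 ltW.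
have q0 : 0 <= s^-1 ^+ j by rewrite exprn_ge0// invr_ge0 ltW.
have e1ex : e1 <= ex.
  by rewrite ler_expR lerN2 -mulrA ler_pM2l// ler_pM2r ?invr_gt0// ltW.
have EEy : E <= Ey.
  rewrite /E /Elayer /Ey mulr_natl mulr2n -/s.
  by apply: lerD; rewrite ler_expR lerN2 mulrA ler_pM2r ?invr_gt0// mulrC
    ler_wpM2r// ltW.
have e10 : 0 <= e1 := expR_ge0 _.
have E0 : 0 <= E by rewrite addr_ge0 ?expR_ge0.
rewrite (_ : 1 + _ + _ + eps^-1 ^+ i * _ * _ * _ = (1 + eps^-1 ^+ i * e1) * (1 + s^-1 ^+ j * E)); last by ring.
rewrite -[leRHS]mulrA; apply: (le_trans (ler_wpM2r _ (ler_norm C'))).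
  by rewrite mulr_ge0// addr_ge0// mulr_ge0.
rewrite ler_wpM2l//.
by apply: ler_pM; rewrite ?addr_ge0 ?mulr_ge0// lerD2l ler_wpM2l.
Qed.

End cell_bounds.

Lemma step_mul_le (R : realType) (hx h t c A B a' b' : R) :
  0 <= h -> 0 <= c -> 0 <= A -> 0 <= B -> hx <= 3 * h * t -> t * A <= a' ->
  0 <= a' -> B <= b' -> hx * (c * A * B) <= 3 * c * h * (a' * b').
Proof.
move=> h0 c0 A0 B0 hxt tA a0 Bb.
apply: (@le_trans _ _ (3 * h * t * (c * A * B))).
  by rewrite ler_wpM2r// !mulr_ge0.
rewrite (_ : 3 * h * t * _ = 3 * c * h * (t * A * B)); last by ring.
rewrite ler_wpM2l ?mulr_ge0//; apply: (@le_trans _ _ (a' * B)).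
  by rewrite ler_wpM2r.
by rewrite ler_wpM2l.
Qed.

(** Here [s ^+ 2] stands for [eps], and [A i], [B j] are the x and y factors of the derivative
    bounds. Multiplying by a step removes one power of the layer width from [A i] or [B j]. In
    [51 = 3 * 17], the 3 comes from the steps, and 17 bounds sums such as [10 + 7 * K] by a multiple
    of [K >= 1]. *)
Lemma interpolation_constants (R : realType) (h s c K x0 D hx k e E : R) :
  0 <= h -> 0 < s <= 1 -> 0 <= c -> 1 <= K -> 0 <= x0 <= 1 -> 0 <= D <= 1 ->
  hx <= 3 * h * (s ^+ 2 + x0) -> k <= 3 * h * (s + D) ->
  0 <= e <= 1 -> (1 + x0 / s ^+ 2) * e <= K ->
  0 <= E <= 2 -> (1 + D / s) * E <= 2 * K ->
  let A i := 1 + (s ^+ 2)^-1 ^+ i * e in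
  let B j := 1 + s^-1 ^+ j * E in
  let w := (1 + x0 / s ^+ 2) * e in
  [/\ hx * (c * A 1%N * B 0%N) + k * (c * A 0%N * B 1%N) <= 51 * c * K * h,
      hx * (c * A 2%N * B 0%N) + k * (c * A 1%N * B 1%N) <= 51 * c * K * h * (1 + w / s ^+ 2)
    & k * (c * A 0%N * B 2%N) + hx * (c * A 1%N * B 1%N) <= 51 * c * K * h / s].
Proof.
move=> h0 /andP[s0 s1] c0 K1 /andP[x00 x01] /andP[D0 D1] hxE kE /andP[e0 e1] wK
  /andP[E0 E2] vK A B w.
have se : s ^+ 2 <= 1 by rewrite expr_le1// ltW.
have si0 : 0 < s^-1 by rewrite invr_gt0.
have si1 : 1 <= s^-1 by rewrite invf_ge1.
have ei0 : 0 < (s ^+ 2)^-1 by rewrite invr_gt0 exprn_gt0.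
have A0' i : 0 <= A i by rewrite addr_ge0// mulr_ge0// exprn_ge0// ltW.
have B0' i : 0 <= B i by rewrite addr_ge0// mulr_ge0// exprn_ge0// ltW.
have A_0 : A 0%N <= 2 by rewrite /A expr0 mul1r; lra.
have B_0 : B 0%N <= 3 by rewrite /B expr0 mul1r; lra.
have w0 : 0 <= w by rewrite mulr_ge0// addr_ge0// divr_ge0// sqr_ge0.
have a1 : (s ^+ 2 + x0) * A 1%N <= 2 + K.
  rewrite (_ : _ * _ = s ^+ 2 + x0 + w);
    last by rewrite /A /w; field; rewrite gt_eqF.
  by rewrite /w; lra.
have a2 : (s ^+ 2 + x0) * A 2%N <= 2 + w / s ^+ 2.
  rewrite (_ : _ * _ = s ^+ 2 + x0 + w / s ^+ 2);
    last by rewrite /A /w; field; rewrite gt_eqF.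
  by rewrite lerD2r; lra.
have b1 : (s + D) * B 1%N <= 2 + 2 * K.
  rewrite (_ : _ * _ = s + D + (1 + D / s) * E);
    last by rewrite /B; field; rewrite gt_eqF.
  by lra.
have b2 : (s + D) * B 2%N <= (2 + 2 * K) / s.
  rewrite (_ : _ * _ = s + D + (1 + D / s) * E / s);
    last by rewrite /B; field; rewrite gt_eqF.
  have : (1 + D / s) * E / s <= 2 * K / s by rewrite ler_pM2r.
  by rewrite mulrDl; lra.
have A_1 : A 1%N <= 1 + w / s ^+ 2.
  by rewrite /A lerD2l expr1 mulrC ler_pM2r// /w ler_peMl// lerDl divr_ge0// sqr_ge0.
have B_1 : B 1%N <= 3 / s.
  rewrite /B expr1; have : s^-1 * E <= s^-1 * 2 by rewrite ler_pM2l.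
  by lra.
have hc0 : 0 <= 3 * c * h by rewrite !mulr_ge0.
have K0 : 0 <= K by lra.
have wE0 : 0 <= w / s ^+ 2 by rewrite divr_ge0// sqr_ge0.
have bnd (a b t : R) : 0 <= t -> a + b <= 17 * K * t ->
    3 * c * h * a + 3 * c * h * b <= 51 * c * K * h * t.
  move=> t0 ab; rewrite -mulrDr; apply: (le_trans (ler_wpM2l hc0 ab)).
  by rewrite le_eqVlt; apply/orP; left; apply/eqP; ring.
split.
- rewrite -[leRHS]mulr1; apply: le_trans (bnd ((2 + K) * 3) ((2 + 2 * K) * 2) 1 _ _) => //; last by lra.
  apply: lerD; first by apply: step_mul_le hxE a1 _ B_0 => //; lra.
  rewrite [c * _ * _]mulrAC; apply: step_mul_le kE b1 _ A_0 => //; lra.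
- apply: le_trans (bnd ((2 + w / s ^+ 2) * 3) ((2 + 2 * K) * (1 + w / s ^+ 2)) _ _ _).
  + apply: lerD; first by apply: step_mul_le hxE a2 _ B_0 => //; lra.
    rewrite [c * _ * _]mulrAC; apply: step_mul_le kE b1 _ A_1 => //; lra.
  + by rewrite addr_ge0.
  + by move: (w / s ^+ 2) wE0 => W W0; nra.
- apply: le_trans (bnd ((2 + 2 * K) / s * 2) ((2 + K) * (3 / s)) _ _ _).
  + apply: lerD; last by apply: step_mul_le hxE a1 _ B_1 => //; lra.
    rewrite [c * _ * _]mulrAC; apply: step_mul_le kE b2 _ A_0 => //.
    by rewrite mulr_ge0 ?(ltW si0)//; lra.
  + exact: ltW.
  + by move: (s^-1) si0 si1 => r r0 r1; nra.
Qed.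

Lemma cell_errors (R : realType) (eps h beta delta C' : R) (u uI : R * R -> R)
    (x0 x1 y0 y1 D a0 a1 a2 a3 : R) :
  0 < h < 1 -> 0 < eps <= 1 -> 0 < beta -> 0 < delta ->
  {within Omegabar, continuous u} -> Ck 2 Omega u ->
  derivative_bounds eps beta delta C' u ->
  0 <= x0 -> x1 <= 1 -> x1 - x0 <= 3 * h * (eps + x0) ->
  0 <= D -> D <= y0 -> y1 <= 1 - D -> y1 - y0 <= 3 * h * (Num.sqrt eps + D) ->
  (forall z, rect x0 x1 y0 y1 z ->
     uI z = a0 + a1 * z.1 + a2 * z.2 + a3 * (z.1 * z.2)) ->
  uI (x0, y0) = u (x0, y0) -> uI (x0, y1) = u (x0, y1) ->
  uI (x1, y0) = u (x1, y0) -> uI (x1, y1) = u (x1, y1) ->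
  forall z, box x0 x1 y0 y1 z ->
  let C0 := 51 * `|C'| * (1 + beta^-1 + delta^-1) in
  let w := (1 + x0 / eps) * expR (- (beta * (x0 / eps))) in
  [/\ `|u z - uI z| <= C0 * h,
      `|Dx (fun z => u z - uI z) z| <= C0 * h * (1 + w / eps)
    & `|Dy (fun z => u z - uI z) z| <= C0 * h / Num.sqrt eps].
Proof.
move=> h01 eps01 beta0 delta0 uc u2 ub x00 x11 hx D0 Dy0 y1D hy uIE E1 E2 E3 E4 z zB C0 w.
have /andP[h0 _] := h01; have /andP[eps0 eps1] := eps01.
have s0 : 0 < Num.sqrt eps by rewrite sqrtr_gt0.
have s2 : Num.sqrt eps ^+ 2 = eps by rewrite sqr_sqrtr// ltW.
have s1 : Num.sqrt eps <= 1 by rewrite -(expr_le1 (n := 2))// ?s2// ltW.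
have BO := @box_Omega _ x0 x1 y0 y1 D x00 x11 D0 Dy0 y1D.
have [/andP[z1 z2] /andP[z3 z4]] := zB.
have {}uc : {within rect x0 x1 y0 y1, continuous u}.
  apply: continuous_subspaceW uc => q [/andP[q1 q2] /andP[q3 q4]].
  by split; apply/andP; split; lra.
have {}u2 := Ck_subset BO u2.
have b_ i j ij := @derivative_bounds_cell _ _ _ _ _ _ eps01 beta0 delta0 ub
  _ _ _ _ _ x00 x11 D0 Dy0 y1D i j ij.
set ex := expR _ in w *.
have bi : 0 < beta^-1 by rewrite invr_gt0.
have di : 0 < delta^-1 by rewrite invr_gt0.
have ex01 : 0 <= ex <= 1.
  by rewrite expR_ge0 -expR0 ler_expR oppr_le0 mulr_ge0 ?(ltW beta0) ?divr_ge0 ?(ltW eps0).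
have Dd : 0 <= D / Num.sqrt eps by rewrite divr_ge0// ltW.
have Ey1 : expR (- (delta * (D / Num.sqrt eps))) <= 1.
  by rewrite -expR0 ler_expR oppr_le0 mulr_ge0// ltW.
have wK : w <= 1 + beta^-1 + delta^-1.
  have := linear_expR_le beta0 (divr_ge0 x00 (ltW eps0)); rewrite -/ex -/w; lra.
have vK : (1 + D / Num.sqrt eps) * (2 * expR (- (delta * (D / Num.sqrt eps))))
    <= 2 * (1 + beta^-1 + delta^-1).
  by rewrite mulrCA ler_pM2l//; have := linear_expR_le delta0 Dd; lra.
have Ey02 : 0 <= 2 * expR (- (delta * (D / Num.sqrt eps))) <= 2.
  by apply/andP; split; have := expR_ge0 (- (delta * (D / Num.sqrt eps))); lra.
have := @interpolation_constants _ h (Num.sqrt eps) `|C'| (1 + beta^-1 + delta^-1)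
  x0 D (x1 - x0) (y1 - y0) ex (2 * expR (- (delta * (D / Num.sqrt eps)))).
rewrite s2 -/w -/C0; case=> //.
- exact: ltW.
- by rewrite s0.
- by lra.
- by rewrite x00; lra.
- by rewrite D0; lra.
move=> B0 B1 B2; split.
- apply: le_trans B0; apply: (interpolation_value zB uc u2 uIE) => //.
  + by move=> q /(b_ 1 0)%N; apply.
  + by move=> q /(b_ 0 1)%N; apply.
- apply: le_trans B1; apply: (interpolation_Dx zB uc u2 uIE) => //.
  + by move=> q /(b_ 2 0)%N; apply.
  + by move=> q /(b_ 1 1)%N; apply.
- apply: le_trans B2; apply: (interpolation_Dy zB uc u2 uIE) => //.
  + by move=> q /(b_ 0 2)%N; apply.
  + by move=> q /(b_ 1 1)%N; apply.
Qed.

(** * Sums over the mesh *)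

Lemma telescope_ord_sumr (R : realType) (F : nat -> R) (n : nat) :
  \sum_(i < n) (F i.+1 - F i) = F n - F 0%N.
Proof. by rewrite -(big_mkord xpredT (fun i => F i.+1 - F i)) telescope_sumr. Qed.

Lemma layer_sum_le (R : realType) (eps h beta : R) (X : nat -> R) (n : nat) :
  0 < eps <= 1 -> 0 < h < 1 -> 0 < beta -> X 0%N = 0 -> X n = 1 ->
  (forall i, (i < n)%N -> [/\ 0 <= X i, X i <= X i.+1
     & X i.+1 - X i <= 3 * h * (eps + X i)]) ->
  eps * (\sum_(i < n) (X i.+1 - X i) *
    (1 + (1 + X i / eps) * expR (- (beta * (X i / eps))) / eps) ^+ 2)
  <= 2 + 8 * ((1 + 2 / beta) ^+ 2) ^+ 2.
Proof.
move=> /andP[eps0 eps1] /andP[h0 h1] beta0 X0 Xn HX.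
set K2 := (1 + 2 / beta) ^+ 2; have K20 : 0 <= K2 by exact: sqr_ge0.
(* The first term of [F] accounts for the summand 1 of the squared weight, the second telescopes the
   layer part [w / eps]. *)
pose F i := 2 * X i - 8 * K2 ^+ 2 * (1 + X i / eps)^-1.
have -> : 2 + 8 * K2 ^+ 2 = F n - F 0%N + 8 * K2 ^+ 2 * (1 + X n / eps)^-1.
  by rewrite /F X0 Xn mul0r addr0 invr1; ring.
have T0 : 0 <= 8 * K2 ^+ 2 * (1 + X n / eps)^-1.
  have ei0 : 0 <= 1 / eps by rewrite divr_ge0// ltW.
  rewrite Xn mulr_ge0//; first by rewrite mulr_ge0// sqr_ge0.
  by rewrite invr_ge0 addr_ge0.
apply: (@le_trans _ _ (F n - F 0%N)); last by rewrite lerDl.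
rewrite -telescope_ord_sumr mulr_sumr; apply: ler_sum => -[i ilt] _ /=.
have [Xi0 Xii Xstep] := HX i ilt.
set xi := X i / eps; set xi' := X i.+1 / eps.
have xi0 : 0 <= xi by rewrite divr_ge0// ltW.
have XE : X i = eps * xi by rewrite mulrC divfK// gt_eqF.
have XE' : X i.+1 = eps * xi' by rewrite mulrC divfK// gt_eqF.
have xixi : xi <= xi' by rewrite ler_pM2r ?invr_gt0.
(* Neighbouring nodes are comparable on the scale of the layer, so one factor [1 + xi] may be traded
   for [1 + xi']; this turns [(1 + xi) ^+ 2] into the product that telescopes. *)
have xi4 : 1 + xi' <= 4 * (1 + xi).
  rewrite -(ler_pM2l eps0) mulrDr -XE' mulrCA mulrDr -XE.
  have : 3 * h * (eps + X i) <= 3 * (eps + X i).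
    by rewrite ler_wpM2r ?addr_ge0 ?(ltW eps0)//; lra.
  by lra.
have := quadratic_expR_le beta0 xi0; rewrite -/K2; set e := expR _ => wK.
have e0 : 0 <= e := expR_ge0 _.
set w := (1 + xi) * e.
have w0 : 0 <= w by rewrite mulr_ge0// addr_ge0.
have w1 : w * (1 + xi) <= K2 by rewrite /w mulrAC -expr2.
clearbody w.
have w2 : w ^+ 2 * ((1 + xi) * (1 + xi')) <= 4 * K2 ^+ 2.
  apply: (@le_trans _ _ (4 * (w * (1 + xi)) ^+ 2)).
    rewrite exprMn [(1 + xi) ^+ 2]expr2 [leRHS]mulrCA ler_wpM2l ?sqr_ge0//.
    by rewrite [leRHS]mulrCA ler_wpM2l// addr_ge0.
  by rewrite ler_pM2l// lerXn2r ?nnegrE// mulr_ge0// addr_ge0.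
have p1 : 0 < 1 + xi by lra.
have p2 : 0 < 1 + xi' by lra.
(* 1 / (1 + xi) is the telescoping majorant of the squared layer weight. *)
have key : (xi' - xi) * w ^+ 2 <= 4 * K2 ^+ 2 * ((1 + xi)^-1 - (1 + xi')^-1).
  rewrite (_ : _^-1 - _^-1 = (xi' - xi) / ((1 + xi) * (1 + xi'))); last first.
    by field; rewrite !gt_eqF.
  by rewrite [leRHS]mulrCA ler_wpM2l ?subr_ge0// ler_pdivlMr ?mulr_gt0.
have sq : (1 + w / eps) ^+ 2 <= 2 + 2 * (w / eps) ^+ 2.
  by have := sqr_ge0 (1 - w / eps); rewrite !expr2; nra.
have d0 : 0 <= X i.+1 - X i by rewrite subr_ge0.
apply: (@le_trans _ _ (eps * ((X i.+1 - X i) * (2 + 2 * (w / eps) ^+ 2)))).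
  by rewrite ler_pM2l// ler_wpM2l.
have -> : eps * ((X i.+1 - X i) * (2 + 2 * (w / eps) ^+ 2)) =
    2 * eps * (X i.+1 - X i) + 2 * ((xi' - xi) * w ^+ 2).
  by rewrite XE XE'; field; rewrite gt_eqF.
have : 2 * eps * (X i.+1 - X i) <= 2 * (X i.+1 - X i).
  by rewrite ler_wpM2r//; lra.
by rewrite /F -/xi -/xi'; lra.
Qed.

(** A cell starting below [sigma] may stick out of the strip, but by the growth condition it ends
    below [4 * (s + sigma)]. The lower cells thus have at most this total length, and the upper ones
    at most [sigma]. *)
Lemma strip_sum_le (R : realType) (s sigma : R) (Y : nat -> R) (n : nat) :
  0 <= s -> 0 <= sigma -> Y 0%N = 0 -> Y n = 1 ->
  (forall j, (j < n)%N -> Y j <= Y j.+1 /\ Y j.+1 <= 4 * (s + Y j)) ->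
  \sum_(j < n) (Y j.+1 - Y j) * ((Y j < sigma) || (1 - sigma < Y j))%:R
  <= 5 * sigma + 4 * s.
Proof.
move=> s0 sg0 Y0 Yn HY.
(* The two clamped coordinates measure the length below [4 * (s + sigma)] and above [1 - sigma]; [F]
   never decreases, and grows by at least the full step on the marked cells. *)
pose F j := Num.min (Y j) (4 * (s + sigma)) + Num.max (Y j) (1 - sigma).
apply: (@le_trans _ _ (F n - F 0%N)); last first.
  rewrite /F Y0 Yn !minEle !maxEle; case: (leP 0 (4 * (s + sigma))) => b1;
  case: (leP 1 (4 * (s + sigma))) => b2; case: (leP 0 (1 - sigma)) => b3;
  case: (leP 1 (1 - sigma)) => b4; lra.
rewrite -telescope_ord_sumr; apply: ler_sum => -[j jlt] _ /=.
have [Yj YS] := HY j jlt; rewrite /F.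
set T := 4 * (s + sigma); set S := 1 - sigma.
have m1 : Num.min (Y j) T <= Num.min (Y j.+1) T.
  by rewrite le_min !ge_min Yj lexx !orbT.
have m2 : Num.max (Y j) S <= Num.max (Y j.+1) S.
  by rewrite ge_max !le_max Yj lexx !orbT.
have [a1|_] := ltP (Y j) sigma => /=.
  have YT : Y j.+1 <= T by rewrite /T; lra.
  rewrite mulr1 (min_l YT) (min_l (le_trans Yj YT)).
  by rewrite opprD addrACA lerDl subr_ge0.
have [a2|_] := boolP (S < Y j); rewrite ?mulr1 ?mulr0; last first.
  by rewrite subr_ge0 lerD.
rewrite (max_l (ltW a2)) (max_l (le_trans (ltW a2) Yj)).
by rewrite opprD addrACA lerDr subr_ge0.
Qed.

(** * Size of the streamline weights in the three subdomains *)

Lemma powR_quarter_ln_le (R : realType) (eps c s : R) : 0 < eps <= 1 -> 0 <= c ->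
  s = Num.sqrt eps ->
  eps `^ (- 4^-1) * (5 * (c * s * `|ln eps|) + 4 * s) <= 20 * c + 4.
Proof.
move=> /andP[eps0 eps1] c0 ->; rewrite -powR12_sqrt ?(ltW eps0)//.
(* The product of the two powers is [expR (- t)] with [t = - ln eps / 4], and [t * expR (- t) <= 1];
   the 20 is 5 times this 4. *)
have -> : eps `^ (- 4^-1) * (5 * (c * eps `^ 2^-1 * `|ln eps|) + 4 * eps `^ 2^-1)
   = (eps `^ (- 4^-1) * eps `^ 2^-1) * (5 * c * `|ln eps| + 4) by ring.
rewrite -powRD ?(gt_eqF eps0) ?implybT// (_ : - 4^-1 + 2^-1 = 4^-1); last by field.
have ln0 : ln eps <= 0 by rewrite ln_le0.
rewrite ler0_norm// /powR gt_eqF//.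
set t := - ln eps / 4.
have -> : 4^-1 * ln eps = - t by rewrite /t; field.
have -> : - ln eps = 4 * t by rewrite /t; field.
have t0 : 0 <= t by rewrite divr_ge0// oppr_ge0.
have h1 : expR (- t) <= 1 by rewrite -expR0 ler_expR oppr_le0.
have h2 : t * expR (- t) <= 1.
  rewrite expRN ler_pdivrMr ?expR_gt0// mul1r.
  by apply: le_trans (expR_ge1Dx t); lra.
have h3 : c * (t * expR (- t)) <= c * 1 by rewrite ler_wpM2l.
rewrite mulrDr; lra.
Qed.

(** Half of the decay rate absorbs the factor [1 + x / eps]; since [c1 > 3 / beta], the other half
    is at most [expR (- (3 / 2) * |ln eps|)], hence at most [eps]. *)
Lemma layer_weight_le (R : realType) (eps beta c1 x : R) : 0 < eps <= 1 ->
  0 < beta -> 3 / beta < c1 -> c1 * eps * `|ln eps| <= x ->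
  (1 + x / eps) * expR (- (beta * (x / eps))) <= (1 + 2 / beta) * eps.
Proof.
move=> /andP[eps0 eps1] beta0 hc1 hx.
have ln0 : ln eps <= 0 by rewrite ln_le0.
have b3 : 0 < 3 / beta by rewrite divr_gt0.
have xi1 : c1 * `|ln eps| <= x / eps by rewrite ler_pdivlMr// mulrAC.
have xi0 : 0 <= x / eps by apply: le_trans xi1; rewrite mulr_ge0//; lra.
have -> : expR (- (beta * (x / eps))) =
    expR (- (beta / 2 * (x / eps))) * expR (- (beta / 2 * (x / eps))).
  by rewrite -expRD; congr expR; field; rewrite gt_eqF.
have b2 : 0 < beta / 2 by rewrite divr_gt0.
rewrite mulrA; apply: ler_pM; rewrite ?mulr_ge0 ?expR_ge0//.
- by rewrite addr_ge0.
- by have := linear_expR_le b2 xi0; rewrite invf_div.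
rewrite -[leRHS](@lnK _ eps) ?posrE// ler_expR lerNl.
apply: (@le_trans _ _ (beta / 2 * (3 / beta * `|ln eps|))).
  rewrite ler0_norm// (_ : beta / 2 * _ = 3 / 2 * - ln eps); first by lra.
  by field; rewrite gt_eqF.
rewrite ler_pM2l//; apply: le_trans xi1.
by rewrite ler_wpM2r// ltW.
Qed.

(** In Omega_1 the parameter is at most a multiple of [eps], the weight that [layer_sum_le] can
    bear. Elsewhere [w <= (1 + 2 / beta) * eps] keeps the squared factor bounded, and the parameter
    costs [eps ^ (- 1/4)] on Omega_2 and 1 on Omega_3. One bound for all three cases allows
    summation without splitting the mesh. *)
Lemma sd_weight_le (R : realType) (eps beta c1 c2 Crho r1 r2 r3 x y M : R) :
  0 < eps <= 1 -> 0 < beta -> 3 / beta < c1 -> 1 <= M -> 0 <= x ->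
  0 <= r1 -> 0 <= r2 -> 0 <= r3 ->
  r1 <= Crho * (eps * M^-1) ->
  r2 <= Crho * (eps `^ (- 4^-1) * M^-1) ->
  r3 <= Crho * (if M `^ (- 2^-1) <= eps then eps^-1 * M^-1
                else M `^ (- 2^-1)) ->
  let w := (1 + x / eps) * expR (- (beta * (x / eps))) in
  let sigma := c2 * Num.sqrt eps * `|ln eps| in
  is_true (sd_param eps c1 c2 r1 r2 r3 x y * (1 + w / eps) ^+ 2 <=
  `|Crho| * (eps * (1 + w / eps) ^+ 2 + (2 + 2 / beta) ^+ 2 *
     (eps `^ (- 4^-1) * ((y < sigma) || (1 - sigma < y))%:R + 1))).
Proof.
move=> eps01 beta0 hc1 M1 x0 r10 r20 r30 hr1 hr2 hr3 w sigma.
have /andP[eps0 eps1] := eps01.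
have M0 : 0 < M by lra.
have Mi0 : 0 < M^-1 by rewrite invr_gt0.
have Mi1 : M^-1 <= 1 by rewrite invf_le1.
have cC : Crho <= `|Crho| := ler_norm _.
have C0 : 0 <= `|Crho| by [].
have w0 : 0 <= w by rewrite mulr_ge0 ?expR_ge0// addr_ge0// divr_ge0// ltW.
have W0 : 0 <= (1 + w / eps) ^+ 2 := sqr_ge0 _.
have p0 : 0 <= eps `^ (- 4^-1) := powR_ge0 _ _.
have K0 : 0 <= (2 + 2 / beta) ^+ 2 := sqr_ge0 _.
have le_abs (t t' : R) : 0 <= t -> t <= t' -> Crho * t <= `|Crho| * t'.
  by move=> t0 tt; apply: (le_trans (ler_wpM2r t0 cC)); rewrite ler_wpM2l.
rewrite /sd_param -/sigma; case: ltP => hx.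
  have : r1 <= `|Crho| * eps.
    by apply: le_trans hr1 (le_abs _ _ _ _); [rewrite ltW// mulr_gt0|rewrite ger_pMr].
  move=> /(ler_wpM2r W0)/le_trans; apply; rewrite -mulrA ler_wpM2l// lerDl.
  by rewrite mulr_ge0// addr_ge0// mulr_ge0.
have W1 : (1 + w / eps) ^+ 2 <= (2 + 2 / beta) ^+ 2.
  have b0 : 0 <= 2 / beta by rewrite divr_ge0// ltW.
  have we0 : 0 <= w / eps by rewrite divr_ge0// ltW.
  rewrite lerXn2r ?nnegrE ?addr_ge0//.
  have := layer_weight_le eps01 beta0 hc1 hx; rewrite -/w -ler_pdivrMr//; lra.
have bnd r (t : R) : 0 <= r -> 0 <= t -> r <= `|Crho| * t ->
   r * (1 + w / eps) ^+ 2 <=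
   `|Crho| * (eps * (1 + w / eps) ^+ 2 + (2 + 2 / beta) ^+ 2 * t).
  move=> r0 t0 rt; apply: (@le_trans _ _ (`|Crho| * t * (2 + 2 / beta) ^+ 2)).
    by apply: ler_pM.
  rewrite -mulrA [t * _]mulrC ler_wpM2l// lerDr.
  by rewrite mulr_ge0// ltW.
case: ifP => _ /=; apply: bnd => //; rewrite ?mulr1 ?mulr0 ?addr_ge0//.
  apply: le_trans hr2 (le_abs _ _ _ _); first by rewrite mulr_ge0// ltW.
  apply: (@le_trans _ _ (eps `^ (- 4^-1))); last by rewrite lerDl.
  by rewrite ger_pMr// powR_gt0.
rewrite add0r; apply: le_trans hr3 (le_abs _ _ _ _).
  by case: ifP => _; rewrite ?powR_ge0// mulr_ge0 ?invr_ge0// ltW.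
have Mh : M `^ (- 2^-1) = (Num.sqrt M)^-1 by rewrite powRN powR12_sqrt// ltW.
have sM : 1 <= Num.sqrt M by rewrite -(@sqrtr1 R) ler_sqrt// ltW.
(* If [M ^ (- 1/2) <= eps], then [M^-1] is the square of [M ^ (- 1/2)] and so at most [eps * 1];
   both branches are thus at most 1. *)
rewrite Mh; case: ifP => [hM|_]; last by rewrite invf_le1// (lt_le_trans _ sM).
have sM0 : 0 < (Num.sqrt M)^-1 by rewrite invr_gt0 (lt_le_trans _ sM).
have -> : M^-1 = (Num.sqrt M)^-1 ^+ 2 by rewrite exprVn sqr_sqrtr// ltW.
rewrite mulrC ler_pdivrMr// mul1r expr2 -[leRHS]mulr1.
by apply: ler_pM => //; rewrite invf_le1// (lt_le_trans _ sM).
Qed.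

(** * Integration over the cells of the mesh *)

#[local] Instance mu2_ae_filter (R : realType) : Filter (almost_everywhere (mu2 R)).
Proof.
exact: (@ae_filter_ringOfSetsType _ _ _ (@lebesgue_measure R \x @lebesgue_measure R)%E).
Qed.

(** Countably many mesh lines form a null set, and off them each coordinate lies strictly between
    two consecutive nodes. *)
Lemma ae_mesh_box (R : realType) (X Y : nat -> R) (nx ny : nat) :
  X 0%N = 0 -> X nx = 1 -> Y 0%N = 0 -> Y ny = 1 ->
  {ae mu2 R, forall z, Omega z -> exists i j : nat,
    [/\ (i < nx)%N, (j < ny)%N & box (X i) (X i.+1) (Y j) (Y j.+1) z]}.
Proof.
move=> X0 X1 Y0 Y1.
have HX : {ae mu2 R, forall z, forall i : nat, z.1 <> X i}.
  by apply/ae_foralln => i; exact: ae_fst_neq.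
have HY : {ae mu2 R, forall z, forall i : nat, z.2 <> Y i}.
  by apply/ae_foralln => i; exact: ae_snd_neq.
apply: filterS2 HX HY => z zX zY [/andP[z1 z2] /andP[z3 z4]].
have [i ilt iz] : exists2 i, (i < nx)%N & X i < z.1 < X i.+1.
  by apply: itv_cover zX; rewrite ?X0 ?X1.
have [j jlt jz] : exists2 j, (j < ny)%N & Y j < z.2 < Y j.+1.
  by apply: itv_cover zY; rewrite ?Y0 ?Y1.
by exists i, j.
Qed.

Lemma OmegaE (R : realType) : @Omega R = box 0 1 0 1.
Proof. by []. Qed.

Lemma integral_le_cells (R : realType) (X Y : nat -> R) (nx ny : nat)
    (B : nat -> nat -> R) (g : R * R -> R) :
  X 0%N = 0 -> X nx = 1 -> Y 0%N = 0 -> Y ny = 1 ->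
  (forall i, (i < nx)%N -> X i <= X i.+1) ->
  (forall j, (j < ny)%N -> Y j <= Y j.+1) ->
  (forall i j, 0 <= B i j) -> (forall z, 0 <= g z) ->
  (forall i j z, (i < nx)%N -> (j < ny)%N ->
     box (X i) (X i.+1) (Y j) (Y j.+1) z -> g z <= B i j) ->
  (\int[mu2 R]_(z in Omega) (g z)%:E <=
   (\sum_(i < nx) \sum_(j < ny)
      B i j * ((X i.+1 - X i) * (Y j.+1 - Y j)))%:E)%E.
Proof.
move=> X0 X1 Y0 Y1 Xle Yle B0 g0 gB.
rewrite pair_big/=.
apply: (@integral_le_boxes _ ('I_nx * 'I_ny)%type _
   (fun p => X p.1) (fun p => X p.1.+1) (fun p => Y p.2) (fun p => Y p.2.+1)
   (fun p => B p.1 p.2)).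
- by rewrite OmegaE; exact: measurable_box.
- by move=> p; exact: Xle.
- by move=> p; exact: Yle.
- by move=> p.
- by move=> z _; rewrite lee_fin.
apply: filterS (ae_mesh_box X0 X1 Y0 Y1) => z H /H[i [j [ilt jlt zB]]].
exists (index (Ordinal ilt, Ordinal jlt) (index_enum ('I_nx * 'I_ny)%type)).
  by rewrite index_mem mem_index_enum.
move=> i0; rewrite nth_index ?mem_index_enum//=; split=> //.
by rewrite lee_fin; exact: gB.
Qed.

Lemma ae_rect_box (R : realType) (a b c d : R) :
  {ae mu2 R, forall z, rect a b c d z -> box a b c d z}.
Proof.
have H1 : {ae mu2 R, forall z, z.1 <> a /\ z.1 <> b}.
  by apply: filterS2 (ae_fst_neq a) (ae_fst_neq b) => z.
have H2 : {ae mu2 R, forall z, z.2 <> c /\ z.2 <> d}.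
  by apply: filterS2 (ae_snd_neq c) (ae_snd_neq d) => z.
apply: filterS2 H1 H2 => z [za zb] [zc zd] [/andP[z1 z2] /andP[z3 z4]].
by split; apply/andP; split; rewrite lt_neqAle ?z1 ?z2 ?z3 ?z4 ?andbT;
  apply/eqP => // e; [apply: za|apply: zc].
Qed.

(** A single box suffices, as the boundary of the closed cell is null. The bound on [b], known only
    almost everywhere, is absorbed by the null set that [integral_le_boxes] allows. *)
Lemma integral_cell_le (R : realType) (b g : R * R -> R) (a1 a2 c1 c2 Kb B : R) :
  a1 <= a2 -> c1 <= c2 -> 0 <= a1 -> a2 <= 1 -> 0 <= c1 -> c2 <= 1 ->
  {ae mu2 R, forall z, Omega z -> `|b z| <= Kb} ->
  (forall z, box a1 a2 c1 c2 z -> `|g z| <= B) ->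
  (L2sq (rect a1 a2 c1 c2) (fun z => (b z * g z)%R) <=
   (Kb ^+ 2 * B ^+ 2 * ((a2 - a1) * (c2 - c1)))%:E)%E.
Proof.
move=> a12 c12 a0 a21 c0 c21 bK gB.
rewrite -[X in (_ <= X%:E)%E](big_seq1 +%R tt
  (fun _ => Kb ^+ 2 * B ^+ 2 * ((a2 - a1) * (c2 - c1)))).
apply: (@integral_le_boxes _ unit [:: tt] (fun=> a1) (fun=> a2) (fun=> c1)
  (fun=> c2) (fun=> Kb ^+ 2 * B ^+ 2)) => //.
- exact: measurable_rect.
- by move=> _; rewrite mulr_ge0 ?sqr_ge0.
- by move=> z _; rewrite lee_fin sqr_ge0.
apply: filterS2 bK (ae_rect_box a1 a2 c1 c2) => z bz rb /rb zB.
exists 0%N => // i0 /=; split=> //.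
have [/andP[z1 z2] /andP[z3 z4]] := zB.
have zO : Omega z by split; apply/andP; split; lra.
rewrite lee_fin -[(_ * _) ^+ 2]real_normK ?num_real// normrM exprMn.
by apply: ler_pM; rewrite ?sqr_ge0// lerXn2r ?nnegrE// ?bz ?gB// (le_trans _ (bz zO), le_trans _ (gB _ zB)).
Qed.

(** * The streamline diffusion norm *)

Lemma L2sq_ge0 (R : realType) (D : set (R * R)) (v : R * R -> R) : (0 <= L2sq D v)%E.
Proof. by apply: integral_ge0 => z _; rewrite lee_fin sqr_ge0. Qed.

Lemma eps_norm_sq_ge0 (R : realType) (eps : R) (v : R * R -> R) : 0 <= eps ->
  (0 <= eps_norm_sq eps v)%E.
Proof.
move=> eps0; rewrite adde_ge0 ?L2sq_ge0// mule_ge0 ?lee_fin//.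
by apply: integral_ge0 => z _; rewrite lee_fin addr_ge0 ?sqr_ge0.
Qed.

(** Since [T <= (T + 1) ^+ 2], the constant [T + 1] can replace the square root of [T]. *)
Lemma poweR_half_le (R : realType) (x : \bar R) (T h : R) :
  (0 <= x)%E -> 0 <= T -> 0 <= h -> (x <= (T * h ^+ 2)%:E)%E ->
  (x `^ 2^-1 <= ((T + 1) * h)%:E)%E.
Proof.
move=> x0 T0 h0 xT.
have Th0 : 0 <= (T + 1) * h by rewrite mulr_ge0// addr_ge0.
have -> : (((T + 1) * h)%:E = (((T + 1) * h) ^+ 2)%:E `^ 2^-1)%E.
  by rewrite poweR_EFin powR12_sqrt ?sqr_ge0// sqrtr_sqr ger0_norm.
apply: gt0_ler_poweR; rewrite ?invr_ge0 ?in_itv/= ?x0 ?leey ?lee_fin ?sqr_ge0//.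
apply: (le_trans xT); rewrite lee_fin exprMn ler_wpM2r ?sqr_ge0//.
by rewrite sqrrD1; have := sqr_ge0 T; lra.
Qed.

Section sd_estimate.
Variables (R : realType) (eps h beta delta C' c1 c2 Crho Kb r1 r2 r3 M : R).
Variables (b u uI : R * R -> R) (X Y : nat -> R) (nx ny : nat).
Hypotheses (h01 : 0 < h < 1) (eps01 : 0 < eps <= 1) (beta0 : 0 < beta)
  (delta0 : 0 < delta) (hc1 : 3 / beta < c1) (c2_ge0 : 0 <= c2).
Hypotheses (uc : {within Omegabar, continuous u}) (u2 : Ck 2 Omega u)
  (ub : derivative_bounds eps beta delta C' u).
Hypothesis bK : {ae mu2 R, forall z, Omega z -> `|b z| <= Kb}.
Hypotheses (X0 : X 0%N = 0) (X1 : X nx = 1) (Y0 : Y 0%N = 0) (Y1 : Y ny = 1).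
Hypothesis HX : forall i, (i < nx)%N -> [/\ 0 <= X i, X i <= X i.+1, X i.+1 <= 1
  & X i.+1 - X i <= 3 * h * (eps + X i)].
Hypothesis HY : forall j, (j < ny)%N -> exists D, [/\ 0 <= D, D <= Y j,
  Y j <= Y j.+1, Y j.+1 <= 1 - D & Y j.+1 - Y j <= 3 * h * (Num.sqrt eps + D)].
Hypothesis M1 : 1 <= M.
Hypotheses (r10 : 0 <= r1) (r20 : 0 <= r2) (r30 : 0 <= r3)
  (hr1 : r1 <= Crho * (eps * M^-1))
  (hr2 : r2 <= Crho * (eps `^ (- 4^-1) * M^-1))
  (hr3 : r3 <= Crho * (if M `^ (- 2^-1) <= eps then eps^-1 * M^-1
                       else M `^ (- 2^-1))).
Hypothesis HI : bilinear_interpolant X nx Y ny u uI.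

Let s : R := Num.sqrt eps.
Let C0 : R := 51 * `|C'| * (1 + beta^-1 + delta^-1).
(** [C0 * h * W i] bounds the x-derivative of the error on column [i]. *)
Let W (i : nat) : R :=
  1 + (1 + X i / eps) * expR (- (beta * (X i / eps))) / eps.
Let v (z : R * R) : R := u z - uI z.
Let chi (j : nat) : R := ((Y j < c2 * s * `|ln eps|) ||
  (1 - c2 * s * `|ln eps| < Y j))%:R.
Let S2 : R := 2 + 8 * ((1 + 2 / beta) ^+ 2) ^+ 2.
Let K3 : R := (2 + 2 / beta) ^+ 2.

Let eps0 : 0 < eps. Proof. by case/andP: eps01. Qed.

Let h_ge0 : 0 <= h. Proof. by apply: ltW; case/andP: h01. Qed.

Let C0_ge0 : 0 <= C0.
Proof. by rewrite !mulr_ge0// !addr_ge0// invr_ge0 ltW. Qed.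

Let Xle i : (i < nx)%N -> X i <= X i.+1.
Proof. by case/HX. Qed.

Let Yle j : (j < ny)%N -> Y j <= Y j.+1.
Proof. by case/HY => D []. Qed.

Let Y_ge0 j : (j < ny)%N -> 0 <= Y j.
Proof. by case/HY => D [D0 DY _ _ _]; exact: le_trans DY. Qed.

Let Y_le1 j : (j < ny)%N -> Y j.+1 <= 1.
Proof. by case/HY => D [D0 _ _ YD _]; apply: (le_trans YD); rewrite gerBl. Qed.

Let errors i j z : (i < nx)%N -> (j < ny)%N ->
  box (X i) (X i.+1) (Y j) (Y j.+1) z ->
  [/\ `|v z| <= C0 * h, `|Dx v z| <= C0 * h * W i & `|Dy v z| <= C0 * h / s].
Proof.
move=> ilt jlt zB; have [Xi0 _ Xi1 Xstep] := HX ilt.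
have [D [D0 DY _ YD Ystep]] := HY jlt.
have [nodes /(_ i j ilt jlt)[a0 [a1 [a2 [a3 aE]]]]] := HI.
by apply: (cell_errors h01 eps01 beta0 delta0 uc u2 ub Xi0 Xi1 Xstep D0 DY YD
  Ystep aE _ _ _ _ zB); apply: nodes; rewrite // ltnW.
Qed.

Let sum_hx : \sum_(i < nx) (X i.+1 - X i) = 1.
Proof. by rewrite telescope_ord_sumr X0 X1 subr0. Qed.

Let sum_hy : \sum_(j < ny) (Y j.+1 - Y j) = 1.
Proof. by rewrite telescope_ord_sumr Y0 Y1 subr0. Qed.

Let sum_W : eps * (\sum_(i < nx) (X i.+1 - X i) * W i ^+ 2) <= S2.
Proof. by apply: layer_sum_le eps01 h01 beta0 X0 X1 _ => i /HX[]. Qed.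

Let sum_chi : eps `^ (- 4^-1) * (\sum_(j < ny) (Y j.+1 - Y j) * chi j)
  <= 20 * c2 + 4.
Proof.
have s0 : 0 <= s := sqrtr_ge0 _.
apply: le_trans (powR_quarter_ln_le eps01 c2_ge0 (erefl s)).
rewrite ler_wpM2l ?powR_ge0//; apply: strip_sum_le => //.
  by rewrite !mulr_ge0.
move=> j jlt; split; first exact: Yle.
have [D [D0 DY _ YD]] := HY jlt; rewrite -/s => Ystep.
have : 3 * h * (s + D) <= 3 * (s + D).
  rewrite ler_wpM2r ?addr_ge0//; have /andP[_ h1] := h01; lra.
lra.
Qed.

(** In [S2 + 2], the term [S2] is the layer sum from [Dx], one unit is [eps * (1 / s) ^+ 2] from
    [Dy], and the other comes from the error itself. *)
Lemma eps_norm_sq_le : (eps_norm_sq eps v <= ((C0 * h) ^+ 2 * (S2 + 2))%:E)%E.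
Proof.
have s2 : s ^+ 2 = eps by rewrite sqr_sqrtr// ltW.
have C0h : 0 <= C0 * h by rewrite mulr_ge0.
have sq (x y : R) : `|x| <= y -> x ^+ 2 <= y ^+ 2.
  move=> xy; rewrite -[x ^+ 2]real_normK ?num_real// lerXn2r ?nnegrE//.
  exact: le_trans xy.
have I1 := @integral_le_cells _ _ _ _ _
  (fun i _ => (C0 * h) ^+ 2 * (W i ^+ 2 + eps^-1))
  (fun z => Dx v z ^+ 2 + Dy v z ^+ 2) X0 X1 Y0 Y1 Xle Yle.
have I2 := @integral_le_cells _ _ _ _ _ (fun _ _ => (C0 * h) ^+ 2)
  (fun z => v z ^+ 2) X0 X1 Y0 Y1 Xle Yle.
have {}I2 : (L2sq Omega v <= ((C0 * h) ^+ 2)%:E)%E.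
  apply: le_trans (I2 _ _ _) _.
  - by move=> _ _; rewrite sqr_ge0.
  - by move=> z; rewrite sqr_ge0.
  - by move=> i j z ilt jlt /(errors ilt jlt)[e _ _]; exact: sq.
  under eq_bigr do rewrite -mulr_sumr -mulr_sumr sum_hy mulr1.
  by rewrite -mulr_sumr sum_hx mulr1.
have {}I1 : (eps%:E * \int[mu2 R]_(z in Omega) (Dx v z ^+ 2 + Dy v z ^+ 2)%:E
    <= ((C0 * h) ^+ 2 * (S2 + 1))%:E)%E.
  apply: (le_trans (lee_wpmul2l _ (I1 _ _ _))).
  - by rewrite lee_fin ltW.
  - by move=> i _; rewrite mulr_ge0 ?sqr_ge0// addr_ge0 ?sqr_ge0// invr_ge0 ltW.
  - by move=> z; rewrite addr_ge0 ?sqr_ge0.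
  - move=> i j z ilt jlt /(errors ilt jlt)[_ /sq ex /sq ey].
    rewrite mulrDr; apply: lerD; first by rewrite -exprMn.
    by rewrite -s2 -exprVn -exprMn.
  rewrite -EFinM lee_fin.
  have -> : \sum_(i < nx) \sum_(j < ny) (C0 * h) ^+ 2 * (W i ^+ 2 + eps^-1) *
      ((X i.+1 - X i) * (Y j.+1 - Y j)) =
    (C0 * h) ^+ 2 * (\sum_(i < nx) (X i.+1 - X i) * W i ^+ 2 + eps^-1).
    under eq_bigr do rewrite -mulr_sumr -mulr_sumr sum_hy mulr1 -mulrA.
    rewrite -mulr_sumr; congr (_ * _).
    under eq_bigr do rewrite mulrDl [W _ ^+ 2 * _]mulrC.
    by rewrite big_split/= -mulr_sumr sum_hx mulr1.
  rewrite mulrCA ler_wpM2l ?sqr_ge0// mulrDr mulfV ?gt_eqF//.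
  by rewrite lerD2r.
rewrite /eps_norm_sq; apply: (le_trans (leeD I1 I2)).
by rewrite -EFinD lee_fin le_eqVlt; apply/orP; left; apply/eqP; ring.
Qed.

Lemma sd_term_le :
  (\sum_(i < nx) \sum_(j < ny)
     (sd_param eps c1 c2 r1 r2 r3 (X i) (Y j))%:E *
     L2sq (cell X Y i j) (fun z => (b z * Dx v z)%R) <=
   (Kb ^+ 2 * (C0 * h) ^+ 2 *
     (`|Crho| * (S2 + K3 * (20 * c2 + 5))))%:E)%E.
Proof.
have C0h : 0 <= C0 * h by rewrite mulr_ge0.
(* Each summand of [G] is a function of [i] times a function of [j], so the double sum reduces to
   [sum_W] and [sum_chi]. The total area 1 of the cells supplies the last unit of [20 * c2 + 5]. *)
pose G i j := Kb ^+ 2 * (C0 * h) ^+ 2 *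
  (`|Crho| * (eps * W i ^+ 2 + K3 * (eps `^ (- 4^-1) * chi j + 1)) *
    ((X i.+1 - X i) * (Y j.+1 - Y j))).
apply: (@le_trans _ _ (\sum_(i < nx) \sum_(j < ny) G i j)%:E).
  rewrite -sumEFin; apply: lee_sum => -[i ilt] _ /=.
  rewrite -sumEFin; apply: lee_sum => -[j jlt] _ /=.
  have [Xi0 Xii Xi1 _] := HX ilt.
  have W0 : 0 <= W i.
    by rewrite addr_ge0// divr_ge0 ?(ltW eps0)// mulr_ge0 ?expR_ge0// addr_ge0//
      divr_ge0// ltW.
  have sd0 : 0 <= sd_param eps c1 c2 r1 r2 r3 (X i) (Y j).
    by rewrite /sd_param; case: ifP => // _; case: ifP.
  have I := integral_cell_le Xii (Yle jlt) Xi0 Xi1 (Y_ge0 jlt) (Y_le1 jlt) bK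
    (fun z zB => let: And3 _ e _ := errors ilt jlt zB in e).
  apply: (le_trans (lee_wpmul2l _ I)); first by rewrite lee_fin.
  rewrite -EFinM lee_fin.
  rewrite (_ : sd_param _ _ _ _ _ _ _ _ * _ = Kb ^+ 2 * (C0 * h) ^+ 2 *
    (sd_param eps c1 c2 r1 r2 r3 (X i) (Y j) * W i ^+ 2 *
     ((X i.+1 - X i) * (Y j.+1 - Y j)))); last by ring.
  rewrite /G; apply: ler_wpM2l; first by rewrite mulr_ge0 ?sqr_ge0.
  apply: ler_wpM2r.
    by rewrite mulr_ge0// subr_ge0// Yle.
  by apply: (sd_weight_le c2 (Y j) eps01 beta0 hc1 M1 Xi0 r10 r20 r30 hr1 hr2 hr3).
rewrite lee_fin.
have -> : \sum_(i < nx) \sum_(j < ny) G i j = Kb ^+ 2 * (C0 * h) ^+ 2 * (`|Crho| *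
    (eps * (\sum_(i < nx) (X i.+1 - X i) * W i ^+ 2) +
     K3 * (eps `^ (- 4^-1) * (\sum_(j < ny) (Y j.+1 - Y j) * chi j) + 1))).
  under eq_bigr do rewrite -mulr_sumr.
  rewrite -mulr_sumr; congr (_ * _).
  transitivity (\sum_(i < nx) \sum_(j < ny)
    (`|Crho| * eps * ((X i.+1 - X i) * W i ^+ 2) * (Y j.+1 - Y j) +
     (X i.+1 - X i) * (`|Crho| * K3 * (eps `^ (- 4^-1) * ((Y j.+1 - Y j) * chi j)
       + (Y j.+1 - Y j))))).
    by apply: eq_bigr => i _; apply: eq_bigr => j _; ring.
  under eq_bigr do rewrite big_split -2!mulr_sumr sum_hy mulr1/=.
  rewrite big_split/= -mulr_sumr -mulr_suml sum_hx mul1r -mulr_sumr big_split/=.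
  by rewrite -mulr_sumr sum_hy; ring.
apply: ler_wpM2l; first by rewrite mulr_ge0 ?sqr_ge0.
apply: ler_wpM2l => //; apply: lerD => //; apply: ler_wpM2l; first exact: sqr_ge0.
by rewrite (_ : 20 * c2 + 5 = 20 * c2 + 4 + 1) ?lerD2r//; ring.
Qed.

Lemma SD_norm_le :
  (SD_norm eps b (fun i j => sd_param eps c1 c2 r1 r2 r3 (X i) (Y j)) X nx Y ny v
    <= ((C0 ^+ 2 * (S2 + 2) + Kb ^+ 2 * C0 ^+ 2 *
          (`|Crho| * (S2 + K3 * (20 * c2 + 5))) + 1) * h)%:E)%E.
Proof.
have S20 : 0 <= S2 by rewrite addr_ge0// mulr_ge0// sqr_ge0.
have K30 : 0 <= K3 := sqr_ge0 _.
rewrite /SD_norm; apply: poweR_half_le => //.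
- apply: adde_ge0; first by apply: eps_norm_sq_ge0; exact: ltW.
  apply: sume_ge0 => i _; apply: sume_ge0 => j _; apply: mule_ge0.
    by rewrite lee_fin /sd_param; case: ifP => // _; case: ifP.
  exact: L2sq_ge0.
- have c20 : 0 <= 20 * c2 + 5 by rewrite addr_ge0// mulr_ge0.
  have T1 : 0 <= S2 + K3 * (20 * c2 + 5) by rewrite addr_ge0// mulr_ge0.
  have T2 : 0 <= S2 + 2 by rewrite addr_ge0.
  apply: addr_ge0; first by apply: mulr_ge0 => //; exact: sqr_ge0.
  by apply: mulr_ge0; apply: mulr_ge0 => //; exact: sqr_ge0.
- apply: (le_trans (leeD eps_norm_sq_le sd_term_le)).
  by rewrite -EFinD lee_fin le_eqVlt; apply/orP; left; apply/eqP; ring.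
Qed.

End sd_estimate.

(** * Bound on the mesh parameter and conclusion *)

Lemma mesh_size_le (R : realType) (h L nx ny : R) : 0 < h < 1 -> 16 <= L ->
  0 <= nx -> 0 <= ny ->
  (nx + 1) * h <= 7 * L -> (ny + 1) * h <= 11 * L ->
  h <= 9 * ((Num.sqrt ((nx + 1) * (ny + 1)))^-1 * L).
Proof.
move=> /andP[h0 h1] L16 nx0 ny0 hx hy.
have M0 : 0 < (nx + 1) * (ny + 1) by rewrite mulr_gt0// ltr_wpDl.
(* After squaring, the left side is the product of [(nx + 1) * h] and [(ny + 1) * h], at most
   [77 * L ^+ 2 <= (9 * L) ^+ 2]. *)
rewrite mulrCA ler_pdivlMl ?sqrtr_gt0// -ler_sqr ?nnegrE; last 2 first.
- by rewrite mulr_ge0 ?sqrtr_ge0// ltW.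
- lra.
rewrite exprMn sqr_sqrtr ?(ltW M0)//.
rewrite (_ : _ * h ^+ 2 = ((nx + 1) * h) * ((ny + 1) * h)); last by ring.
apply: (@le_trans _ _ (7 * L * (11 * L))).
  by apply: ler_pM => //; apply: mulr_ge0; lra.
by rewrite exprMn expr2; have := sqr_ge0 L; rewrite expr2; lra.
Qed.

Theorem theorem4 (R : realType) (beta gamma : R) (b bx by_ c : R * R -> R)
    (delta C' c1 c2 Crho kappa : R)
    (hbeta : 0 < beta) (hgamma : 0 < gamma)
    (hb : W1oo b bx by_) (hc : Loo c)
    (hb_ge : {ae mu2 R, forall z, Omega z -> beta <= b z})
    (hc_ge : {ae mu2 R, forall z, Omega z -> 0 <= c z})
    (hcoer : {ae mu2 R, forall z, Omega z -> gamma <= c z + 2^-1 * bx z})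
    (hdelta : 0 < delta)
    (hc1 : 3 / beta < c1) (hc2 : 3 / (2 * delta) < c2)
    (hkappa : 0 < kappa) :
  exists eps0 : R, 0 < eps0 < 1 /\
  forall f u : R -> R * R -> R,
    (forall eps, 0 < eps <= eps0 ->
       [/\ L2 (f eps), solves eps b c (f eps) (u eps)
         & derivative_bounds eps beta delta C' (u eps)]) ->
  exists C : R,
  forall (eps h : R) (Mx My : nat) (r1 r2 r3 : R) (uI : R * R -> R),
    0 < eps <= eps0 -> 0 < h < 1 ->
    dl_last h eps 1 Mx -> dl_last h (Num.sqrt eps) 2^-1 My ->
    let nx := dl_size kappa h eps 1 Mx in
    let my := dl_size kappa h (Num.sqrt eps) 2^-1 My in
    let ny := (2 * my)%N in
    let X := dl_x h eps nx in
    let Y := dl_y h eps my in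
    let M : R := (nx.+1 * ny.+1)%:R in
    0 <= r1 -> 0 <= r2 -> 0 <= r3 ->
    r1 <= Crho * (eps * M^-1) ->
    r2 <= Crho * (eps `^ (- 4^-1) * M^-1) ->
    r3 <= Crho * (if M `^ (- 2^-1) <= eps then eps^-1 * M^-1
                  else M `^ (- 2^-1)) ->
    bilinear_interpolant X nx Y ny (u eps) uI ->
    (SD_norm eps b (fun i j => sd_param eps c1 c2 r1 r2 r3 (X i) (Y j))
       X nx Y ny (fun z => u eps z - uI z)%R <= (C * h)%:E)%E /\
    h <= C * ((Num.sqrt M)^-1 * `|ln eps|).
Proof.
(* Then [sqrt eps <= expR (- 8) <= 1/9], which yields the condition [4 * s <= L] of [dl_size_spec]
   in both directions, and [|ln eps| >= 16] absorbs additive constants. *)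
exists (expR (- 16)).
have e16 : 0 < expR (- 16 : R) < 1 by rewrite expR_gt0 expR_lt1; lra.
split=> // f u fu.
have [_ [Kb bK]] : Loo b by case: hb.
pose C0 : R := 51 * `|C'| * (1 + beta^-1 + delta^-1).
pose S2 : R := 2 + 8 * ((1 + 2 / beta) ^+ 2) ^+ 2.
pose T : R := C0 ^+ 2 * (S2 + 2) + Kb ^+ 2 * C0 ^+ 2 *
  (`|Crho| * (S2 + (2 + 2 / beta) ^+ 2 * (20 * c2 + 5))) + 1.
(* [T] serves the norm estimate and 9 the bound on [h]; [T] is fixed by the data before [eps], [h]
   and the mesh are introduced. *)
exists (T + 9) => eps h Mx My r1 r2 r3 uI heps h01 hMx hMy nx my ny X Y M
  r10 r20 r30 hr1 hr2 hr3 HI.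
have [_ [uc _ u2 _] ub] := fu eps heps.
have /andP[eps_gt0 eps_le] := heps.
have /andP[_ e1] := e16.
have eps1 : eps <= 1 by lra.
have eps01 : 0 < eps <= 1 by rewrite eps_gt0.
have ln_eps : ln eps <= - 16 by rewrite -(expRK (- 16)) ler_ln ?posrE ?expR_gt0.
have s0 : 0 < Num.sqrt eps by rewrite sqrtr_gt0.
have s2 : Num.sqrt eps ^+ 2 = eps by rewrite sqr_sqrtr// ltW.
have ln_s : 2 * ln (Num.sqrt eps) = ln eps.
  by rewrite -[in RHS]s2 lnXn ?posrE// mulr_natl.
have s8 : Num.sqrt eps <= 1 / 9.
  rewrite -(@lnK _ (Num.sqrt eps)) ?posrE//.
  apply: (@le_trans _ _ (expR (- 8))); first by rewrite ler_expR; lra.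
  rewrite expRN div1r lef_pV2 ?posrE ?expR_gt0//.
  by have := expR_ge1Dx (8 : R); lra.
have eps4 : 4 * eps <= 1 by rewrite -s2 expr2; nra.
have [nx0 nxL Lnx nxh] := @dl_size_spec _ _ _ h01 eps_gt0 kappa 1 Mx (lexx 1) eps4 hMx.
have half1 : 2^-1 <= 1 :> R by lra.
have s4 : 4 * Num.sqrt eps <= 2^-1 by lra.
have [my0 myL Lmy myh] := @dl_size_spec _ _ _ h01 s0 kappa 2^-1 My half1 s4 hMy.
rewrite -/nx in nx0 nxL Lnx nxh; rewrite -/my in my0 myL Lmy myh.
have HX i : (i < nx)%N -> [/\ 0 <= X i, X i <= X i.+1, X i.+1 <= 1
    & X i.+1 - X i <= 3 * h * (eps + X i)].
  exact: (dl_half_spec h01 eps_gt0 nxL Lnx).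
have HY j : (j < ny)%N -> exists D, [/\ 0 <= D, D <= Y j, Y j <= Y j.+1,
    Y j.+1 <= 1 - D & Y j.+1 - Y j <= 3 * h * (Num.sqrt eps + D)].
  exact: dl_y_spec.
have X0 : X 0%N = 0 by rewrite /X /dl_x nx0.
have X1 : X nx = 1 by rewrite /X /dl_x ltnn.
have Y0 : Y 0%N = 0 by rewrite /Y /dl_y my0.
have Y1 : Y ny = 1 by rewrite /Y /ny dl_y_sym// subnn -/Y Y0 subr0.
have M1 : 1 <= M by rewrite /M ler1n.
have d32 : 0 < 3 / (2 * delta) by rewrite divr_gt0// mulr_gt0.
have c20 : 0 <= c2 by lra.
have T0 : 0 <= T.
  have S20 : 0 <= S2 by rewrite addr_ge0// mulr_ge0// sqr_ge0.
  have S22 : 0 <= S2 + 2 by rewrite addr_ge0.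
  have c25 : 0 <= 20 * c2 + 5 by rewrite addr_ge0// mulr_ge0.
  have T1 : 0 <= S2 + (2 + 2 / beta) ^+ 2 * (20 * c2 + 5).
    by rewrite addr_ge0// mulr_ge0// sqr_ge0.
  apply: addr_ge0 => //; apply: addr_ge0.
    by apply: mulr_ge0 => //; exact: sqr_ge0.
  by apply: mulr_ge0; apply: mulr_ge0 => //; exact: sqr_ge0.
have /andP[h0 h1] := h01.
split.
  apply: (le_trans (SD_norm_le h01 eps01 hbeta hdelta hc1 c20 uc u2 ub bK X0 X1 Y0 Y1
    HX HY M1 r10 r20 r30 hr1 hr2 hr3 HI)).
  by rewrite lee_fin ler_wpM2r ?(ltW h0)// -/C0 -/S2 -/T lerDl.
have L0 : 0 <= `|ln eps| by [].
have LE : `|ln eps| = - ln eps by rewrite ler0_norm//; lra.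
have M0 : 0 <= (Num.sqrt M)^-1 * `|ln eps| by rewrite mulr_ge0// invr_ge0 sqrtr_ge0.
apply: (@le_trans _ _ (9 * ((Num.sqrt M)^-1 * `|ln eps|))); last first.
  by rewrite ler_wpM2r// lerDr.
have -> : M = (nx%:R + 1) * (ny%:R + 1).
  by rewrite /M -[nx.+1]addn1 -[ny.+1]addn1 natrM !natrD.
(* With [L = |ln eps|], [dl_size_spec] gives [(nx + 1) * h <= 5 + 2 * L] and, as
   [- 2 * ln (sqrt eps) = L] and [ny = 2 * my], [(ny + 1) * h <= 9 + 2 * L]; these are at most
   [7 * L] and [11 * L]. *)
apply: mesh_size_le => //; first by lra.
  by rewrite mulrDl mul1r; lra.
rewrite /ny natrM mulrDl mul1r -mulrA; lra.
Qed.
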